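(* For $d\ge2$ and any root $a$ of the hypercube $Q_d$, there are isomorphisms of real algebras \begin{align*} \mathcal B_a(Q_d)&\cong M_d(\mathbb R)\oplus M_{d-1}(\mathbb R)\oplus\mathbb R^{\max\{d-3,0\}},\\ e\mathcal T(a)e&\cong M_d(\mathbb R)\oplus\bigoplus_{j=1}^{\lfloor d/2\rfloor}M_{d-2j+1}(\mathbb R). \end{align*} For $d=1$ both algebras are $\mathbb R$. Therefore the two algebras $\mathcal B_a(Q_d)$ and $e\mathcal T(a)e$ are equal, as subalgebras of the algebra of matrices on the residual vertex set $V(Q_d)\setminus\{a\}$, precisely for $1\le d\le4$. For $d\ge2$, $$\dim\mathcal B_a(Q_d)=d^2+(d-1)^2+\max\{d-3,0\}.$$
   Context: All algebras are over $\mathbb R$; $\langle\cdots\rangle$ denotes the real unital algebra generated. $Q_d$ is the $d$-dimensional hypercube graph. For a finite simple connected regular graph $G$ with at least two vertices and $a\in V(G)$: $B=A(G-a)$ is the adjacency matrix of the vertex-deleted graph, $E$ is the diagonal matrix indexed by $V(G)\setminus\{a\}$ whose diagonal is the indicator of the neighbourhood $N(a)$, and $\mathcal B_a=\mathcal B_a(G)=\langle I,B,E\rangle$. With $A$ the adjacency matrix of $G$, $D$ the eccentricity of $a$, and $E_i^*$ the diagonal projection of $\mathbb R^{V(G)}$ onto the vertices at distance $i$ from $a$, the Terwilliger algebra is $\mathcal T(a)=\langle A,E_0^*,\ldots,E_D^*\rangle$. Put $e=I-E_0^*$; the corner $e\mathcal T(a)e$ is identified with an algebra of operators on $\mathbb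 R^{V(G)\setminus\{a\}}$. Empty direct sums are omitted. *)

(* Defs.v *)
From HB Require Import structures.
From mathcomp Require Import all_boot all_order all_algebra.
From mathcomp Require Import boolp classical_sets reals.

Set Implicit Arguments.
Unset Strict Implicit.
Unset Printing Implicit Defensive.

Import GRing.Theory.
Local Open Scope classical_set_scope.
Local Open Scope ring_scope.

(* 'M[R]_n with n possibly 0 (and products of such) is only a pzRingType and an
   lmodType: MathComp's lalgType asks for 1 != 0.  Hence subalgebras and
   algebra isomorphisms are phrased here with these two structures. *)

Section DirectSum.
Variables (R : pzRingType) (I : finType) (n : I -> nat).

Definition mxsum : Type := {dffun forall i : I, 'M[R]_(n i)}.
HB.instance Definition _ := Choice.on mxsum.

Definition mxsum_map (F : forall i, 'M[R]_(n i)) : mxsum :=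
  [ffun i : I => F i : 'M[R]_(n i)].

Lemma mxsumE F i : mxsum_map F i = F i.
Proof. by rewrite ffunE. Qed.

Lemma mxsumP (x y : mxsum) : (forall i, x i = y i) -> x = y.
Proof. by move=> xy; apply/ffunP. Qed.

Let zero := mxsum_map (fun=> 0).
Let opp (x : mxsum) := mxsum_map (fun i => - x i).
Let add (x y : mxsum) := mxsum_map (fun i => x i + y i).
Let one := mxsum_map (fun=> 1%:M).
Let mul (x y : mxsum) := mxsum_map (fun i => x i *m y i).
Let scale (k : R) (x : mxsum) := mxsum_map (fun i => k *: x i).

Fact mxsum_addA : associative add.
Proof. by move=> x y z; apply/mxsumP => i; rewrite !mxsumE addrA. Qed.
Fact mxsum_addC : commutative add.
Proof. by move=> x y; apply/mxsumP => i; rewrite !mxsumE addrC. Qed.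
Fact mxsum_add0 : left_id zero add.
Proof. by move=> x; apply/mxsumP => i; rewrite !mxsumE add0r. Qed.
Fact mxsum_addN : left_inverse zero opp add.
Proof. by move=> x; apply/mxsumP => i; rewrite !mxsumE addNr. Qed.
HB.instance Definition _ := GRing.isZmodule.Build mxsum
  mxsum_addA mxsum_addC mxsum_add0 mxsum_addN.

Fact mxsum_mulA : associative mul.
Proof. by move=> x y z; apply/mxsumP => i; rewrite !mxsumE mulmxA. Qed.
Fact mxsum_mul1l : left_id one mul.
Proof. by move=> x; apply/mxsumP => i; rewrite !mxsumE mul1mx. Qed.
Fact mxsum_mul1r : right_id one mul.
Proof. by move=> x; apply/mxsumP => i; rewrite !mxsumE mulmx1. Qed.
Fact mxsum_mulDl : left_distributive mul add.
Proof. by move=> x y z; apply/mxsumP => i; rewrite !mxsumE mulmxDl. Qed.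
Fact mxsum_mulDr : right_distributive mul add.
Proof. by move=> x y z; apply/mxsumP => i; rewrite !mxsumE mulmxDr. Qed.
HB.instance Definition _ := GRing.Zmodule_isPzRing.Build mxsum
  mxsum_mulA mxsum_mul1l mxsum_mul1r mxsum_mulDl mxsum_mulDr.

Fact mxsum_scaleA k l x : scale k (scale l x) = scale (k * l) x.
Proof. by apply/mxsumP => i; rewrite !mxsumE scalerA. Qed.
Fact mxsum_scale1 : left_id 1 scale.
Proof. by move=> x; apply/mxsumP => i; rewrite !mxsumE scale1r. Qed.
Fact mxsum_scaleDr : right_distributive scale +%R.
Proof. by move=> k x y; apply/mxsumP => i; rewrite !mxsumE scalerDr. Qed.
Fact mxsum_scaleDl x : {morph scale^~ x : k l / k + l}.
Proof. by move=> k l; apply/mxsumP => i; rewrite !mxsumE scalerDl. Qed.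
HB.instance Definition _ := GRing.Zmodule_isLmodule.Build R mxsum
  mxsum_scaleA mxsum_scale1 mxsum_scaleDr mxsum_scaleDl.

End DirectSum.

Notation "\oplus_ ( j < k ) ''M[' R ]_ n" := (mxsum R (fun j : 'I_k => n%N))
  (at level 36, j at level 36, k at level 50, R at level 200, n at level 8,
   format "\oplus_ ( j  <  k )  ''M[' R ]_ n") : type_scope.

Section MatrixAlgebras.
Variables (R : realType) (n : nat).
Implicit Types (S G : set 'M[R]_n) (M N : 'M[R]_n).

Definition is_subalgebra S : Prop :=
  [/\ S 1%:M,
      forall (k : R) M N, S M -> S N -> S (k *: M + N) &
      forall M N, S M -> S N -> S (M *m N)].

Definition gen_alg G : set 'M[R]_n := smallest is_subalgebra G.

(* The target B is an algebra given by its ring structure and its scaling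
   (filled in by the notation S ~=alg B below); f is the isomorphism B -> S.
   Such an f makes S a unital subalgebra of the matrix algebra. *)
Definition alg_iso S (B : pzRingType) (scale : R -> B -> B) : Prop :=
  exists f : {rmorphism B -> 'M[R]_n},
    [/\ forall k x, f (scale k x) = k *: f x, injective f & range f = S].

Definition has_dim S (k : nat) : Prop :=
  exists U : {vspace 'M[R]_n}, S = [set M | M \in U] /\ \dim U = k.

End MatrixAlgebras.

Notation "S ~=alg B" := (@alg_iso _ _ S B%type (@GRing.scale _ B%type))
  (at level 70, no associativity).

Section Graph.
Variables (R : realType) (V : finType) (e : rel V) (a : V).

(* Matrices indexed by a finite type T are 'M_#|T|, through enum_val. *)
Definition adjmx (T : finType) (r : rel T) : 'M[R]_#|T| :=
  \matrix_(i, j) (r (enum_val i) (enum_val j))%:R.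

Definition indmx (T : finType) (P : pred T) : 'M[R]_#|T| :=
  \matrix_(i, j) ((i == j) && P (enum_val i))%:R.

Definition residual : finType := {x : V | x != a}.

Definition del_adj : rel residual := fun x y => e (val x) (val y).

Definition algB : set 'M[R]_#|residual| :=
  gen_alg [set adjmx del_adj; indmx (fun x : residual => e a (val x))].

(* Length of a shortest walk (equal to #|V| if there is no walk). *)
Definition gdist (x y : V) : nat :=
  find (fun k => [exists p : k.-tuple V, path e x p && (last x p == y)])
       (iota 0 #|V|).

Definition eccentricity : nat := \max_(y : V) gdist a y.

Definition dual_idem (i : nat) : 'M[R]_#|V| := indmx (fun x => gdist a x == i).

Definition terwilliger : set 'M[R]_#|V| :=
  gen_alg (adjmx e |` [set dual_idem i | i in [set i | (i <= eccentricity)%N]]).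

Definition off_root : 'M[R]_#|V| := 1%:M - dual_idem 0.

Definition to_residual (M : 'M[R]_#|V|) : 'M[R]_#|residual| :=
  let f (i : 'I_#|residual|) := enum_rank (val (enum_val i)) in mxsub f f M.

(* Elements of the corner vanish on the row and the column of a;
   to_residual drops these. *)
Definition corner : set 'M[R]_#|residual| :=
  [set to_residual (off_root *m M *m off_root) | M in terwilliger].

End Graph.

Arguments algB R {V} e a.
Arguments terwilliger R {V} e a.
Arguments corner R {V} e a.

Definition cube (d : nat) : finType := {ffun 'I_d -> bool}.

Definition cube_adj (d : nat) : rel (cube d) :=
  fun x y => #|[pred i | x i != y i]| == 1%N.

(* Main.v *)
From HB Require Import structures.
Require Import Defs.
From mathcomp Require Import all_boot all_order all_algebra.
From mathcomp Require Import boolp classical_sets reals.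
From mathcomp Require Import zify ring.

(** Count coordinates from the root, so that the level of a vertex is its
    distance to the root. The adjacency matrix of the cube is the sum of an
    operator [X] that raises the level and an operator [Y] that lowers it, and
    these satisfy the relations of sl2: the functions on the cube form the
    [d]-th tensor power of the two-dimensional representation. They split into
    isotypic parts, one for each lowest level [j <= d / 2]; the part [j] lives
    on the levels [j, ..., d - j], and its irreducible constituent meets each
    of these levels in a line. The Terwilliger algebra contains [X], [Y] and
    the projections onto the levels, so it acts on the part [j] as the full
    matrix algebra of size [d - 2j + 1]. All this is made explicit by matrix
    units. The parts are separated by a Casimir element that is central and
    annihilated by a product of distinct linear factors
    ([casimir_annihilated]); lowest vectors ([cube_lowest_vector]) show that no
    part is zero; the units ([sl2_unit]) move along the strings
    [v, X v, X^2 v, ...] above the lowest vectors. Deleting the root removes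
    the first level of the part 0 and nothing else, which gives the corner
    ([corner_span]).

    In the basis of a string, the adjacency matrix [B] of the residual graph
    acts as a weighted path, and the indicator [F] of the neighbourhood is the
    projection onto level 1. This level is the first vertex of the path in the
    parts 0 and 1 and is absent from the others. The matrix [F B^2 F] takes
    different values in the parts 0 and 1, which separates them; a path with
    nonzero weights and a marked end vertex generates all matrices, so both
    parts contribute their full matrix algebras, of sizes [d] and [d - 1]. On
    the other parts [F] vanishes and [B] alone is left. There its matrix is a
    Sylvester-Kac matrix, with the simple eigenvalues
    [d - 2j, d - 2j - 2, ..., -(d - 2j)]; all of them occur for [j = 2], so
    that, if [d >= 4], these parts together contribute one line for each of the
    [d - 3] eigenvalues of the part 2 ([algebra_units]). The two algebras differ as
    soon as the part 2, where one is commutative and the other a full matrix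
    algebra, has size at least 2, which means [d >= 5]
    ([path_algebra_full]). *)

Set Implicit Arguments.
Unset Strict Implicit.
Unset Printing Implicit Defensive.
Import Order.TTheory GRing.Theory Num.Theory.
Local Open Scope ring_scope.

(** * Subalgebras and generated algebras *)

Section Subalgebras.
Variables (R : realType) (n : nat).
Implicit Types (S G : set 'M[R]_n) (M N : 'M[R]_n).

Section Closure.
Variables (S : set 'M[R]_n) (SS : is_subalgebra S).

Lemma subalg1 : S 1%:M. Proof. by case: SS. Qed.
Lemma subalgM M N : S M -> S N -> S (M *m N).
Proof. by case: SS => _ _; apply. Qed.
Lemma subalg0 : S 0.
Proof.
by case: SS => S1 SL _; have := SL (-1) _ _ S1 S1; rewrite scaleN1r addNr.
Qed.
Lemma subalgD M N : S M -> S N -> S (M + N).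
Proof. by case: SS => _ SL _ SM SN; have := SL 1 _ _ SM SN; rewrite scale1r. Qed.
Lemma subalgZ k M : S M -> S (k *: M).
Proof. by case: SS => _ SL _ SM; have := SL k _ _ SM subalg0; rewrite addr0. Qed.
Lemma subalgB M N : S M -> S N -> S (M - N).
Proof. by move=> SM SN; rewrite -scaleN1r; apply: subalgD => //; apply: subalgZ. Qed.
Lemma subalg_sum (I : finType) (P : pred I) (F : I -> 'M[R]_n) :
  (forall i, P i -> S (F i)) -> S (\sum_(i | P i) F i).
Proof. by move=> SF; apply: big_ind => //; [exact: subalg0|exact: subalgD]. Qed.
Lemma subalg_scalar k : S k%:M.
Proof. by rewrite -scalemx1; apply/subalgZ/subalg1. Qed.
Lemma subalgX M k : S M -> S (M ^+ k).
Proof.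
move=> SM; elim: k => [|k IH]; first by rewrite expr0; exact: subalg1.
by rewrite exprS; apply: subalgM.
Qed.

End Closure.

Lemma gen_alg_subalgebra G : is_subalgebra (gen_alg G).
Proof.
split=> [S [SS _]|k M N GM GN S SG|M N GM GN S SG]; first exact: subalg1.
- by case: (SG) => SS _; case: (SS) => _ + _; apply; [exact: GM|exact: GN].
- by apply: subalgM; [case: SG|exact: GM|exact: GN].
Qed.

Lemma gen_alg_incl G M : G M -> gen_alg G M.
Proof. by move=> GM S [_]; apply. Qed.

Lemma gen_alg_min G S : is_subalgebra S -> (G `<=` S)%classic ->
  (gen_alg G `<=` S)%classic.
Proof. by move=> SS GS M; apply. Qed.

Lemma centralizer_subalgebra X :
  is_subalgebra [set M : 'M[R]_n | M *m X = X *m M]%classic.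
Proof.
split=> [|k M N /= MX NX|M N /= MX NX]; first by rewrite /= mul1mx mulmx1.
- by rewrite mulmxDl mulmxDr -scalemxAl -scalemxAr MX NX.
- by rewrite -mulmxA NX mulmxA MX mulmxA.
Qed.

End Subalgebras.

(** * Spectral idempotents of a diagonalizable matrix *)

Section Spectral.
Variable R : realType.

(** The product of the [X - c i] has distinct roots, so each divisibility
    amounts to the vanishing of a polynomial at the points [c i]; the [l i]
    are the Lagrange polynomials of these points. *)
Lemma lagrange_partition m (c : 'I_m -> R) : injective c ->
  exists l : 'I_m -> {poly R},
    [/\ forall i j, (l i).[c j] = (i == j)%:R,
        \prod_i ('X - (c i)%:P) %| 1 - \sum_i l i,
        forall i j, i != j -> \prod_i ('X - (c i)%:P) %| l i * l j &
        forall i, \prod_i ('X - (c i)%:P) %| ('X - (c i)%:P) * l i].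
Proof.
move=> c_inj.
pose l i := (\prod_(k | k != i) (c i - c k))^-1%:P
              * \prod_(k | k != i) ('X - (c k)%:P).
have l_val i j : (l i).[c j] = (i == j)%:R.
  rewrite /l hornerM hornerC horner_prod.
  case: eqVneq => [->|ij]; last first.
    rewrite eq_sym in ij.
    rewrite [X in _ * X](bigD1 j) //= hornerXsubC.
    by rewrite subrr mul0r mulr0.
  under [X in _ * X]eq_bigr do rewrite hornerXsubC.
  rewrite mulVf //; apply/prodf_neq0 => k ki.
  by rewrite subr_eq0 inj_eq // eq_sym.
have dvdE p : (forall j, p.[c j] = 0) -> \prod_i ('X - (c i)%:P) %| p.
  move=> p0; rewrite -(big_map c predT (fun x => 'X - x%:P)).
  apply: uniq_roots_dvdp.
    by apply/allP => _ /mapP[j _ ->]; apply/rootP/p0.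
  by rewrite uniq_rootsE map_inj_uniq // /index_enum -enumT enum_uniq.
exists l; split => // [|i j ij|i].
- apply: dvdE => j; rewrite hornerD hornerN hornerC horner_sum.
  rewrite (bigD1 j) //= l_val eqxx big1 ?addr0 ?subrr // => i ij.
  by rewrite l_val (negPf ij).
- apply: dvdE => k; rewrite hornerM !l_val.
  case: (eqVneq i k) => [<-|_]; last by rewrite mul0r.
  by rewrite eq_sym (negPf ij) mulr0.
- rewrite (bigD1 i) //= /l mulrCA; apply/dvdpP; exists (\prod_(k | k != i) (c i - c k))^-1%:P.
  by [].
Qed.

(** The [pi k] are the Lagrange polynomials of the points [c k], evaluated
    at [M] and multiplied by [f]; being such, they lie in every subalgebra
    that contains [M] and [f]. The idempotent [f] confines the statement to
    a part of the space on which [M] has known eigenvalues. *)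
Lemma spectral_idempotents n (M f : 'M[R]_n) m (c : 'I_m -> R) :
  injective c -> f *m f = f -> M *m f = f *m M ->
  (\prod_k (M - (c k)%:M)) *m f = 0 ->
  exists pi : 'I_m -> 'M[R]_n,
    [/\ \sum_k pi k = f,
        forall k l, pi k *m pi l = if k == l then pi k else 0,
        forall k, M *m pi k = c k *: pi k,
        forall k, pi k *m M = c k *: pi k &
        forall S, is_subalgebra S -> S M -> S f -> forall k, S (pi k)].
Proof.
case: n M f => [|n] M f c_inj ff Mf q0.
  (* Evaluation of polynomials at a matrix is available for nonzero sizes;
     in size 0 all matrices vanish. *)
  exists (fun=> 0); rewrite !flatmx0.
  by split=> [|k l|k|k|S SS _ _ k]; rewrite ?flatmx0 //; exact: subalg0.
have hornerS S p : is_subalgebra S -> S M -> S (horner_mx M p).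
  move=> SS SM; elim/poly_ind: p => [|p a IH]; first by rewrite raddf0; exact: subalg0.
  rewrite rmorphD rmorphM /= horner_mx_X horner_mx_C.
  by apply: subalgD => //; [apply: subalgM|apply: subalg_scalar].
have comm_f p : horner_mx M p *m f = f *m horner_mx M p.
  by apply: (hornerS _ p (centralizer_subalgebra f)).
have [l [lc l1 lij lX]] := lagrange_partition c_inj.
have killf p : \prod_i ('X - (c i)%:P) %| p -> horner_mx M p *m f = 0.
  move=> /dvdpP[q ->]; rewrite rmorphM /= -[_ * _]/(_ *m _) -mulmxA.
  rewrite rmorph_prod /=.
  under eq_bigr do rewrite rmorphB /= horner_mx_X horner_mx_C.
  by rewrite q0 mulmx0.
have fl k : f *m horner_mx M (l k) *m f = horner_mx M (l k) *m f.
  by rewrite -comm_f -mulmxA ff.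
have lX0 k : M *m (horner_mx M (l k) *m f) = c k *: (horner_mx M (l k) *m f).
  apply/eqP; rewrite -subr_eq0 -mul_scalar_mx -mulmxBl mulmxA.
  have -> : M - (c k)%:M = horner_mx M ('X - (c k)%:P).
    by rewrite rmorphB /= horner_mx_X horner_mx_C.
  by rewrite -[X in X *m f]/(_ * _) -rmorphM /= killf.
exists (fun k => horner_mx M (l k) *m f); split=> [|k i|k|k|S SS SM Sf k].
- apply/eqP; rewrite -mulmx_suml -rmorph_sum /= -subr_eq0 -oppr_eq0 opprB.
  rewrite -{1}[f]mul1mx -mulmxBl.
  by rewrite -[X in (X - _) *m f](rmorph1 (horner_mx M)) -rmorphB /= killf.
- rewrite mulmxA -[in LHS](mulmxA _ f) -comm_f mulmxA -mulmxA ff.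
  case: eqVneq => [<-|ki]; last by rewrite -[X in X *m f]/(_ * _) -rmorphM /= killf // lij.
  apply/eqP; rewrite -subr_eq0 -mulmxBl -[X in (X - _) *m f]/(_ * _).
  rewrite -rmorphM -rmorphB /= killf //.
  have -> : l k * l k - l k = - (l k * (1 - \sum_i l i)) - \sum_(i | i != k) l k * l i.
    rewrite (bigD1 k) //= -mulr_sumr; ring.
  rewrite dvdp_sub ?dvdpNr ?dvdp_mull //.
  apply: (big_ind (fun p => _ %| p)) => [|p q|i' ik]; [exact: dvdp0|exact: dvdp_add|].
  by rewrite lij // eq_sym.
- exact: lX0.
- by rewrite -mulmxA -Mf mulmxA (comm_horner_mx (l k) (erefl (M *m M))) -mulmxA lX0.
- by apply: subalgM => //; apply: hornerS.
Qed.

Lemma prod_eigen n p (M : 'M[R]_n) (X : 'M[R]_(n, p)) mu (I : Type) (s : seq I) (c : I -> R) :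
  M *m X = mu *: X ->
  (\prod_(k <- s) (M - (c k)%:M)) *m X = (\prod_(k <- s) (mu - c k)) *: X.
Proof.
move=> MX; elim: s => [|k s IH]; first by rewrite !big_nil mul1mx scale1r.
rewrite !big_cons -[X in X *m _]/(_ *m _) -mulmxA IH -scalemxAr mulmxBl MX.
by rewrite mul_scalar_mx -scalerBl scalerA mulrC.
Qed.

End Spectral.

(** * Systems of matrix units *)

Section MatrixUnits.
Variables (R : realType) (N : nat) (K : finType) (n : K -> nat).
Variable w : K -> nat -> nat -> 'M[R]_N.

(** Plain numbers as row and column indices keep the family [w] free of
    dependent types; the condition says nothing about the values outside the
    range of the block sizes. *)
Definition matrix_units : Prop :=
  [/\ forall k p q l r s, (p < n k)%N -> (q < n k)%N -> (r < n l)%N -> (s < n l)%N ->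
        w k p q *m w l r s = if (k == l) && (q == r) then w k p s else 0,
      \sum_k \sum_(p < n k) w k p p = 1%:M &
      forall k p, (p < n k)%N -> w k p p != 0].

Definition units_map (x : mxsum R n) : 'M[R]_N :=
  \sum_k \sum_(p < n k) \sum_(q < n k) x k p q *: w k p q.

Definition units_span : set 'M[R]_N := range units_map.

Hypothesis wP : matrix_units.

Lemma units_mapZD a x y : units_map (a *: x + y) = a *: units_map x + units_map y.
Proof.
rewrite /units_map scaler_sumr -big_split; apply: eq_bigr => k _ /=.
rewrite scaler_sumr -big_split; apply: eq_bigr => p _ /=.
rewrite scaler_sumr -big_split; apply: eq_bigr => q _ /=.
have -> : (a *: x + y) k = a *: x k + y k by rewrite !mxsumE.
by rewrite !mxE scalerDl scalerA.
Qed.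

Lemma units_map1 : units_map 1 = 1%:M.
Proof.
case: wP => _ <- _; apply: eq_bigr => k _; apply: eq_bigr => p _.
rewrite (bigD1 p) //= big1 ?addr0 => [|q qp]; rewrite mxsumE mxE ?eqxx ?scale1r //.
by rewrite eq_sym (negPf qp) scale0r.
Qed.

(** A unit on the left picks one row of the coefficients, which reduces the
    product of two combinations of units to the matrix product. *)
Lemma unit_units_map k p q x : (p < n k)%N -> forall qk : (q < n k)%N,
  w k p q *m units_map x = \sum_(s < n k) x k (Ordinal qk) s *: w k p s.
Proof.
move=> pk qk; case: wP => wM _ _.
rewrite /units_map mulmx_sumr (bigD1 k) //= addrC big1 ?add0r => [|l lk].
  rewrite mulmx_sumr (bigD1 (Ordinal qk)) //= addrC big1 ?add0r => [|r rq].
    rewrite mulmx_sumr; apply: eq_bigr => s _.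
    by rewrite -scalemxAr wM //= !eqxx.
  rewrite mulmx_sumr big1 // => s _; rewrite -scalemxAr wM // eqxx /=.
  case: eqP => [qr|]; last by rewrite scaler0.
  by case/eqP: rq; apply: val_inj; rewrite /= qr.
rewrite mulmx_sumr big1 // => r _; rewrite mulmx_sumr big1 // => s _.
by rewrite -scalemxAr wM // eq_sym (negPf lk) scaler0.
Qed.

Lemma units_mapM x y : units_map (x * y) = units_map x *m units_map y.
Proof.
rewrite {2}/units_map mulmx_suml; apply: eq_bigr => k _.
rewrite mulmx_suml; apply: eq_bigr => p _.
rewrite mulmx_suml.
under [RHS]eq_bigr => q _ do rewrite -scalemxAl (unit_units_map _ (ltn_ord p) (ltn_ord q)) scaler_sumr.
rewrite exchange_big; apply: eq_bigr => s _ /=.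
have -> : (x * y) k = x k *m y k by rewrite !mxsumE.
rewrite mxE scaler_suml; apply: eq_bigr => q _.
by rewrite scalerA; congr (_ * y k _ _ *: _); apply: val_inj.
Qed.

Lemma units_neq0 k p q : (p < n k)%N -> (q < n k)%N -> w k p q != 0.
Proof.
move=> pk qk; case: wP => wM _ w0; apply: contra (w0 k p pk) => /eqP wpq.
by have := wM k p q k q p pk qk qk pk; rewrite !eqxx wpq mul0mx /= => <-.
Qed.

(** Multiplying by diagonal units on both sides isolates one coefficient. *)
Lemma units_map_inj : injective units_map.
Proof.
move=> x y xy; apply/mxsumP => k; apply/matrixP => p q; case: (wP) => wM _ _.
have coef z : w k p p *m units_map z *m w k q q = z k p q *: w k p q.
  rewrite (unit_units_map _ (ltn_ord p) (ltn_ord p)) mulmx_suml (bigD1 q) //= big1 ?addr0.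
    rewrite -scalemxAl wM // !eqxx /=; congr (z k _ _ *: _); exact: val_inj.
  move=> s sq; rewrite -scalemxAl wM // eqxx /=.
  by case: eqP => [sq'|]; rewrite ?scaler0 //; case/eqP: sq; apply: val_inj.
have /eqP := coef x; rewrite xy coef -subr_eq0 -scalerBl scaler_eq0.
by rewrite (negPf (units_neq0 (ltn_ord p) (ltn_ord q))) orbF subr_eq0 => /eqP.
Qed.

Lemma units_span_subalgebra : is_subalgebra units_span.
Proof.
split=> [|a _ _ [x _ <-] [y _ <-]|_ _ [x _ <-] [y _ <-]].
- by exists 1; rewrite // units_map1.
- by exists (a *: x + y); rewrite // units_mapZD.
- by exists (x * y); rewrite // units_mapM.
Qed.

Lemma units_span_unit k p q : (p < n k)%N -> (q < n k)%N -> units_span (w k p q).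
Proof.
move=> pk qk; case: (wP) => wM _ _.
have SS := units_span_subalgebra.
exists (mxsum_map (fun l => \matrix_(i, j) [&& l == k, i == p :> nat & j == q :> nat]%:R)) => //.
rewrite /units_map (bigD1 k) //= [X in _ + X]big1 ?addr0 => [|l lk].
  rewrite (bigD1 (Ordinal pk)) //= [X in _ + X]big1 ?addr0 => [|r rp].
    rewrite (bigD1 (Ordinal qk)) //= [X in _ + X]big1 ?addr0 => [|s sq].
      by rewrite mxsumE mxE !eqxx scale1r.
    by rewrite mxsumE mxE -[s == q :> nat]/(s == Ordinal qk) (negPf sq) !andbF scale0r.
  by rewrite big1 // => s _; rewrite mxsumE mxE -[r == p :> nat]/(r == Ordinal pk) (negPf rp) andbF scale0r.
by rewrite big1 // => r _; rewrite big1 // => s _; rewrite mxsumE mxE (negPf lk) scale0r.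
Qed.

Lemma units_span_min S : is_subalgebra S ->
  (forall k p q, (p < n k)%N -> (q < n k)%N -> S (w k p q)) ->
  (units_span `<=` S)%classic.
Proof.
move=> SS Sw _ [x _ <-]; do 3![apply: (subalg_sum SS) => ? _].
by apply/(subalgZ SS)/Sw.
Qed.

(** The diagonal units sum to 1, so [M] is the sum of its products with
    them; hence a matrix that maps the units into their span belongs to it. *)
Lemma units_span_left M :
  (forall k p, (p < n k)%N -> units_span (M *m w k p p)) -> units_span M.
Proof.
case: (wP) => _ w1 _ MS; rewrite -[M]mulmx1 -w1 mulmx_sumr.
apply: (subalg_sum units_span_subalgebra) => k _; rewrite mulmx_sumr.
by apply: (subalg_sum units_span_subalgebra) => p _; apply: MS.
Qed.

Lemma units_span_iso : units_span ~=alg mxsum R n.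
Proof.
have F0 : zmod_morphism units_map.
  by move=> x y; rewrite addrC -scaleN1r units_mapZD scaleN1r addrC.
have F1 : monoid_morphism units_map by split; [exact: units_map1|exact: units_mapM].
pose F : {rmorphism mxsum R n -> 'M[R]_N} :=
  HB.pack units_map (GRing.isZmodMorphism.Build _ _ _ F0) (GRing.isMonoidMorphism.Build _ _ _ F1).
exists F; split=> [k x||] //=; last exact: units_map_inj.
have := units_mapZD k x 0; rewrite addr0 => ->.
have -> : units_map 0 = 0 := raddf0 F.
by rewrite addr0.
Qed.

End MatrixUnits.

Section Transfer.
Variables (R : realType) (N : nat) (S : set 'M[R]_N).

Lemma alg_iso_trans (B C : pzRingType) (sB : R -> B -> B) (sC : R -> C -> C)
    (phi : B -> C) (psi : C -> B) :
  zmod_morphism phi -> monoid_morphism phi ->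
  (forall k x, phi (sB k x) = sC k (phi x)) -> cancel phi psi -> cancel psi phi ->
  alg_iso S sC -> alg_iso S sB.
Proof.
move=> phiB phiM phiZ phiK psiK [f [fZ f_inj fS]].
pose F : {rmorphism B -> C} :=
  HB.pack phi (GRing.isZmodMorphism.Build _ _ _ phiB) (GRing.isMonoidMorphism.Build _ _ _ phiM).
exists (f \o F : {rmorphism B -> 'M[R]_N}); split=> [k x||].
- by rewrite /= phiZ fZ.
- exact: inj_comp f_inj (can_inj phiK).
- rewrite -fS; apply/seteqP; split=> [_ [x _ <-]|_ [x _ <-]].
    by exists (phi x).
  by exists (psi x) => //=; rewrite psiK.
Qed.

(** The target is a vector space of known dimension, and the isomorphism is
    an injective linear map whose image is [S]. *)
Lemma alg_iso_dim (n m l : nat) :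
  S ~=alg 'M[R]_n * 'M[R]_m * {ffun 'I_l -> R^o} ->
  has_dim S (n ^ 2 + m ^ 2 + l).
Proof.
set B := ('M[R]_n * 'M[R]_m * {ffun 'I_l -> R^o})%type.
move=> [f [fZ f_inj fS]].
have f_lin : linear f by move=> k x y; rewrite raddfD /= fZ.
pose g : {linear B -> 'M[R]_N} := HB.pack (f : B -> 'M[R]_N) (GRing.isLinear.Build R B 'M[R]_N _ _ f_lin).
exists (limg (linfun g)); split.
  rewrite -fS; apply/seteqP; split=> [_ [x _ <-]|M /memv_imgP [x _ ->]] /=.
    by apply/memv_imgP; exists x; rewrite ?memvf //; apply: esym; exact: (lfunE g).
  by exists x => //; apply: esym; exact: (lfunE g).
rewrite limg_dim_eq; last first.
  apply/eqP; rewrite -subv0; apply/subvP => x /memv_capP[_]; rewrite memv_ker memv0 => /eqP; rewrite (lfunE g) => gx0.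
  have fx0 : f x = f 0 by rewrite raddf0.
  by rewrite (f_inj _ _ fx0).
rewrite dimvf -!mulnn -[in RHS](muln1 l) -[in RHS](card_ord l).
exact: erefl.
Qed.

End Transfer.

(** * Graded representations of sl2 and their Casimir element *)

(** A representation of sl2 split into its weight spaces: level [i] is the
    space of weight [d - 2i], and [X], [Y] are the operators that raise and
    lower the level. The last condition makes each lowest weight up to the
    middle level occur. *)
Record graded_sl2 (R : realType) (N d : nat) (X Y : 'M[R]_N) (E : nat -> 'M[R]_N) : Prop := GradedSl2 {
  level_mul : forall i j, E i *m E j = if i == j then E i else 0;
  level_sum : \sum_(i < d.+1) E i = 1%:M;
  raiseE : forall i, X *m E i = E i.+1 *m X;
  raise0 : E 0 *m X = 0;
  lowerE : forall i, Y *m E i.+1 = E i *m Y;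
  lower0 : Y *m E 0 = 0;
  sl2_comm : Y *m X - X *m Y = \sum_(i < d.+1) (d%:R - i%:R *+ 2) *: E i;
  lowest_vector : forall j, (j.*2 <= d)%N ->
    exists v : 'cV[R]_N, [/\ v != 0, E j *m v = v & Y *m v = 0] }.

Section Sl2.
Variables (R : realType) (N d : nat) (X Y : 'M[R]_N) (E : nat -> 'M[R]_N).
Hypothesis H : graded_sl2 d X Y E.

Let EE := level_mul H.
Let XE := raiseE H.
Let YE := lowerE H.

(** The value of the Casimir element below on vectors of level [i] killed by
    [Y]. It is symmetric under [i -> d + 1 - i] and injective on the lower
    half of the levels. *)
Definition casimir_value (d i : nat) : R := - (i%:R * (d%:R + 1 - i%:R)).
Local Notation g := (casimir_value d).
Definition casimir : 'M[R]_N := X *m Y + \sum_(i < d.+1) g i *: E i.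
Local Notation Om := casimir.

Lemma level_out i : (d < i)%N -> E i = 0.
Proof.
move=> di; rewrite -[E i]mulmx1 -(level_sum H) mulmx_sumr big1 // => k _.
by rewrite EE; case: eqP => // ik; have := ltn_ord k; lia.
Qed.

Lemma level_lin (c : nat -> R) i : (\sum_(k < d.+1) c k *: E k) *m E i = c i *: E i.
Proof.
rewrite mulmx_suml; case: (ltnP i d.+1) => id; last first.
  by rewrite level_out // scaler0 big1 // => k _; rewrite mulmx0.
rewrite (bigD1 (Ordinal id)) //= -scalemxAl EE eqxx big1 ?addr0 // => k ki.
rewrite -scalemxAl EE; case: eqP => [ki'|]; rewrite ?scaler0 //.
by case/eqP: ki; apply: val_inj.
Qed.

Lemma level_lin_comm (c : nat -> R) i : E i *m (\sum_(k < d.+1) c k *: E k) = c i *: E i.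
Proof.
rewrite -level_lin mulmx_sumr mulmx_suml; apply: eq_bigr => k _.
by rewrite -scalemxAl -scalemxAr !EE eq_sym; case: eqP => // ->.
Qed.

Lemma eq_on_levels m (M M' : 'M[R]_(m, N)) : (forall i, M *m E i = M' *m E i) -> M = M'.
Proof.
move=> MM; rewrite -[M]mulmx1 -[M']mulmx1 -(level_sum H) !mulmx_sumr.
exact: eq_bigr.
Qed.

Lemma raise_lower_level i : E i *m (X *m Y) = X *m Y *m E i.
Proof.
case: i => [|i]; first by rewrite mulmxA (raise0 H) mul0mx -mulmxA (lower0 H) mulmx0.
by rewrite mulmxA -XE -!mulmxA YE.
Qed.

Lemma casimir_level i : Om *m E i = E i *m Om.
Proof. by rewrite mulmxDl mulmxDr level_lin level_lin_comm raise_lower_level. Qed.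

Lemma raise_lower i : X *m Y *m E i = (Om - (g i)%:M) *m E i.
Proof. by rewrite mulmxBl mulmxDl level_lin mul_scalar_mx addrK. Qed.

(** The commutation relation turns the value [g i] into [g i.+1], because [g
    i - g i.+1 = d - 2i]. *)
Lemma lower_raise i : Y *m X *m E i = (Om - (g i.+1)%:M) *m E i.
Proof.
rewrite -[Y *m X](subrK (X *m Y)) (sl2_comm H) mulmxDl.
rewrite (level_lin (fun i => d%:R - i%:R *+ 2)) raise_lower !mulmxBl !mul_scalar_mx addrCA.
congr (_ + _); rewrite -scaleNr -scalerDl -scaleNr; congr (_ *: _).
by rewrite /casimir_value -natr1; ring.
Qed.

Lemma casimir_low i : Om *m E i = X *m Y *m E i + g i *: E i.
Proof. by rewrite raise_lower mulmxBl mul_scalar_mx subrK. Qed.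

Lemma casimir_high i : Om *m E i = Y *m X *m E i + g i.+1 *: E i.
Proof. by rewrite lower_raise mulmxBl mul_scalar_mx subrK. Qed.

(** On level [i.+1] the Casimir element is read from [X *m Y], on level [i]
    from [Y *m X]; both readings involve the same number [g i.+1]. *)
Lemma casimir_raise : Om *m X = X *m Om.
Proof.
apply: eq_on_levels => i; rewrite -!mulmxA XE casimir_high mulmxA casimir_low.
by rewrite mulmxDl mulmxDr -!scalemxAl -!scalemxAr -!mulmxA !XE.
Qed.

Lemma casimir_lower : Om *m Y = Y *m Om.
Proof.
apply: eq_on_levels => -[|i].
  by rewrite -!mulmxA (lower0 H) mulmx0 casimir_level mulmxA (lower0 H) mul0mx.
rewrite -!mulmxA YE casimir_low mulmxA casimir_high.
by rewrite mulmxDl mulmxDr -!scalemxAl -!scalemxAr -!mulmxA !YE.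
Qed.

Lemma mulmx_expr_comm n (M Z : 'M[R]_n) k : M *m Z = Z *m M -> M *m Z ^+ k = Z ^+ k *m M.
Proof.
move=> MZ; elim: k => [|k IH]; first by rewrite expr0 mulmx1 mul1mx.
by rewrite exprS -[Z * _]/(Z *m _) mulmxA MZ -mulmxA IH mulmxA.
Qed.

Lemma expmxS n (M : 'M[R]_n) k : M ^+ k.+1 = M *m M ^+ k.
Proof. exact: exprS. Qed.
Lemma expmxSr n (M : 'M[R]_n) k : M ^+ k.+1 = M ^+ k *m M.
Proof. exact: exprSr. Qed.

Lemma raiseXE k i : X ^+ k *m E i = E (i + k) *m X ^+ k.
Proof.
elim: k i => [|k IH] i; first by rewrite expr0 mulmx1 mul1mx addn0.
by rewrite expmxSr -mulmxA XE mulmxA IH -mulmxA addSnnS.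
Qed.

Lemma lowerXE k i : Y ^+ k *m E (i + k) = E i *m Y ^+ k.
Proof.
elim: k i => [|k IH] i; first by rewrite expr0 mulmx1 mul1mx addn0.
by rewrite addnS expmxSr -mulmxA YE mulmxA IH -mulmxA.
Qed.

Lemma casimir_shift (c : R) (M : 'M[R]_N) : Om *m M = M *m Om ->
  (Om - c%:M) *m M = M *m (Om - c%:M).
Proof. by move=> OM; rewrite mulmxBl mulmxBr OM scalar_mxC. Qed.

(** The innermost [X *m Y] acts on its level as the Casimir element minus a
    number; that difference commutes with the remaining powers and can be
    moved out. *)
Lemma raise_lowerX k a :
  X ^+ k *m Y ^+ k *m E (a + k) = (\prod_(a.+1 <= m < (a + k).+1) (Om - (g m)%:M)) *m E (a + k).
Proof.
elim: k a => [|k IH] a; first by rewrite addn0 big_geq // !expr0 !mul1mx.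
rewrite big_ltn; last by lia.
rewrite -[in RHS]mulmxE -!mulmxA -addSnnS -IH.
rewrite expmxSr expmxS -!mulmxA lowerXE (mulmxA X) (mulmxA (X *m Y)) raise_lower.
by rewrite !mulmxA (casimir_shift _ (mulmx_expr_comm k casimir_raise)).
Qed.

(** The roots met on the way up are the values at the levels [i + 1, ..., i
    + k]; by the symmetry of [g] they are also the values at [a + 1, ..., a
    + k], which makes the products for low and for high levels comparable. *)
Lemma lower_raiseX k i a : (i + k + a)%N = d ->
  Y ^+ k *m X ^+ k *m E i = (\prod_(a.+1 <= m < (a + k).+1) (Om - (g m)%:M)) *m E i.
Proof.
elim: k a => [|k IH] a ika; first by rewrite addn0 big_geq // !expr0 !mul1mx.
rewrite big_ltn; last by lia.
rewrite -[in RHS]mulmxE -!mulmxA -[in RHS]addSnnS -IH; last by lia.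
rewrite expmxSr expmxS -!mulmxA raiseXE (mulmxA Y) (mulmxA (Y *m X)) lower_raise.
have -> : g (i + k).+1 = g a.+1.
  rewrite /casimir_value -ika -!natr1 !natrD; ring.
by rewrite !mulmxA (casimir_shift _ (mulmx_expr_comm k casimir_lower)).
Qed.

Lemma casimir_prod_level (s : seq nat) i :
  (\prod_(m <- s) (Om - (g m)%:M)) *m E i = E i *m \prod_(m <- s) (Om - (g m)%:M).
Proof.
elim: s => [|m s IH]; first by rewrite big_nil mul1mx mulmx1.
rewrite big_cons -[(Om - _) * _]/(_ *m _).
by rewrite -mulmxA IH !mulmxA casimir_shift // casimir_level.
Qed.

(** Lowering [i + 1] times annihilates level [i]. *)
Lemma low_level_vanish i : (\prod_(0 <= m < i.+1) (Om - (g m)%:M)) *m E i = 0.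
Proof.
rewrite big_ltn // -[X in X *m _]/(_ *m _) -mulmxA.
have := raise_lowerX i 0; rewrite !add0n => <-.
rewrite !mulmxA (casimir_shift _ (mulmx_expr_comm i casimir_raise)).
rewrite -2!mulmxA (_ : Y ^+ i *m E i = E 0 *m Y ^+ i); last by rewrite -(lowerXE i 0) add0n.
by rewrite (mulmxA (_ - _)) -raise_lower -(mulmxA X) (lower0 H) mulmx0 mul0mx mulmx0.
Qed.

(** Raising [d - i + 1] times annihilates level [i]; the last factor has the
    root [g d.+1 = g 0]. *)
Lemma high_level_vanish i : (i <= d)%N ->
  (\prod_(0 <= m < (d - i).+1) (Om - (g m)%:M)) *m E i = 0.
Proof.
move=> id; rewrite big_ltn // -[X in X *m _]/(_ *m _) -mulmxA.
have <- := @lower_raiseX (d - i) i 0; last by lia.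
rewrite !mulmxA (casimir_shift _ (mulmx_expr_comm _ casimir_lower)).
rewrite -2!mulmxA raiseXE subnKC // (mulmxA (_ - _)).
have -> : g 0 = g d.+1 by rewrite /casimir_value -natr1; ring.
by rewrite -lower_raise -(mulmxA Y) XE level_out // mul0mx mulmx0 mul0mx mulmx0.
Qed.

(** A level in the lower half is treated by lowering, one in the upper half
    by raising. In this way only the values up to the middle level are
    needed as roots, and these are distinct. *)
Lemma casimir_annihilated : \prod_(m < (d %/ 2).+1) (Om - (g m)%:M) = 0.
Proof.
apply: eq_on_levels => i; rewrite mul0mx.
case: (leqP i d) => id; last by rewrite level_out // mulmx0.
rewrite -(big_mkord xpredT (fun m => Om - (g m)%:M)).
have part k : (k <= d %/ 2)%N -> (\prod_(0 <= m < k.+1) (Om - (g m)%:M)) *m E i = 0 ->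
    (\prod_(0 <= m < (d %/ 2).+1) (Om - (g m)%:M)) *m E i = 0.
  move=> kd k0; rewrite (@big_cat_nat _ _ _ k.+1) //=.
  by rewrite -[X in X *m _]/(_ *m _) -mulmxA casimir_prod_level mulmxA k0 mul0mx.
case: (leqP i (d %/ 2)) => ih; first exact/(part i ih)/low_level_vanish.
by apply/(part (d - i)%N)/high_level_vanish => //; lia.
Qed.

Lemma casimir_valueB j m : g j - g m = (m%:R - j%:R) * (d%:R + 1 - (j + m)%:R).
Proof. by rewrite /casimir_value natrD; ring. Qed.

Lemma casimir_value_neq j m : j != m -> (j + m != d.+1)%N -> g j - g m != 0.
Proof.
move=> jm jmd; rewrite casimir_valueB mulf_neq0 // subr_eq0.
  by rewrite eqr_nat eq_sym.
by rewrite natr1 eqr_nat eq_sym.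
Qed.

End Sl2.

(** * Matrix units of a graded sl2-representation *)

(** [P j] is the projection onto the isotypic part of lowest level [j], that
    is onto the eigenspace of the Casimir element for its value at [j]. *)
Record isotypic (R : realType) (N d : nat) (X Y : 'M[R]_N) (E P : nat -> 'M[R]_N) : Prop := Isotypic {
  isotypic_sum : \sum_(j < ((d %/ 2)%N).+1) P j = 1%:M;
  isotypic_mul : forall i j, (i <= d %/ 2)%N -> (j <= d %/ 2)%N ->
    P i *m P j = if i == j then P i else 0;
  isotypic_casimir : forall j, (j <= d %/ 2)%N -> casimir d X Y E *m P j = casimir_value R d j *: P j;
  isotypic_mem : forall S, is_subalgebra S -> S (casimir d X Y E) ->
    forall j, S (P j) }.

Section Sl2Units.
Variables (R : realType) (N d : nat) (X Y : 'M[R]_N) (E : nat -> 'M[R]_N).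
Hypothesis H : graded_sl2 d X Y E.
Local Notation g := (casimir_value R d).
Local Notation Om := (casimir d X Y E).
Local Notation h := (d %/ 2)%N.

Lemma isotypic_exists : exists P, isotypic d X Y E P.
Proof.
have g_inj : injective (fun j : 'I_h.+1 => g j).
  move=> i j gij; apply: val_inj; apply/eqP; apply/negPn/negP => ij.
  have := @casimir_value_neq R d i j ij; rewrite gij subrr eqxx.
  have := ltn_ord i; have := ltn_ord j => hi hj /(_ ltac:(lia)) //.
have [pi [pi1 piM Opi _ piS]] := @spectral_idempotents R N Om 1%:M _ _ g_inj
  (mul1mx _) (scalar_mxC _ _) (ltac:(by rewrite mulmx1 (casimir_annihilated H))).
exists (fun j => pi (inord j)); split.
- by rewrite -pi1; apply: eq_bigr => j _; rewrite inord_val.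
- move=> i j ih jh; rewrite piM; congr (if _ then _ else _).
  by rewrite -val_eqE /= !inordK.
- by move=> j jh; rewrite Opi inordK.
- by move=> S SS SO j; apply: piS => //; exact: subalg1.
Qed.

Variable P : nat -> 'M[R]_N.
Hypothesis HP : isotypic d X Y E P.

Lemma isotypic_comm Z j : Om *m Z = Z *m Om -> Z *m P j = P j *m Z.
Proof.
by move=> OZ; apply: esym; apply: (isotypic_mem HP (centralizer_subalgebra Z)).
Qed.

Lemma isotypic_raise j : X *m P j = P j *m X.
Proof. exact/isotypic_comm/(casimir_raise H). Qed.
Lemma isotypic_lower j : Y *m P j = P j *m Y.
Proof. exact/isotypic_comm/(casimir_lower H). Qed.
Lemma isotypic_level j i : E i *m P j = P j *m E i.
Proof. exact/isotypic_comm/(casimir_level H). Qed.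

Lemma isotypic_raise_lower j i : (j <= h)%N ->
  X *m Y *m (P j *m E i) = (g j - g i) *: (P j *m E i).
Proof.
move=> jh; rewrite -isotypic_level mulmxA (raise_lower H) -mulmxA isotypic_level.
by rewrite mulmxBl mulmxA (isotypic_casimir HP) // mul_scalar_mx -scalemxAl -scalerBl.
Qed.

Lemma isotypic_lower_raise j i : (j <= h)%N ->
  Y *m X *m (P j *m E i) = (g j - g i.+1) *: (P j *m E i).
Proof.
move=> jh; rewrite -isotypic_level mulmxA (lower_raise H) -mulmxA isotypic_level.
by rewrite mulmxBl mulmxA (isotypic_casimir HP) // mul_scalar_mx -scalemxAl -scalerBl.
Qed.

(** On the other levels an annihilating product of the Casimir element has
    no factor that vanishes on the part [j]. *)
Lemma isotypic_support j i : (j <= h)%N -> (i < j)%N || (d - j < i)%N -> P j *m E i = 0.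
Proof.
move=> jh ij; case: (leqP i d) => id; last by rewrite (level_out H) // mulmx0.
have kill k : (\prod_(0 <= m < k.+1) (Om - (g m)%:M)) *m E i = 0 ->
    (k < j)%N -> P j *m E i = 0.
  move=> k0 kj; have OPE : Om *m (P j *m E i) = g j *: (P j *m E i).
    by rewrite mulmxA (isotypic_casimir HP) // scalemxAl.
  have := prod_eigen (index_iota 0 k.+1) g OPE.
  rewrite -isotypic_level mulmxA k0 mul0mx => /esym/eqP.
  rewrite scaler_eq0 => /orP[|/eqP //]; rewrite prodf_seq_eq0 => /hasP[m].
  rewrite mem_index_iota /= => mk; rewrite (negPf (casimir_value_neq _ _ _)) //; lia.
case/orP: ij => ij; first exact/(kill i)/ij/(low_level_vanish H).
by apply: (kill (d - i)%N); [exact: high_level_vanish|lia].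
Qed.

(** As [Y] is adjoint to [X] on the cube, this is the quotient of the
    squared norms of [X ^+ k *m v] and [v] for a vector [v] of level [j]
    killed by [Y]. *)
Definition path_norm (j k : nat) : R := \prod_(t < k) (g j - g (j + t).+1).

Lemma path_norm_neq0 j k : (j <= h)%N -> (j + k <= d - j)%N -> path_norm j k != 0.
Proof.
move=> jh jk; apply/prodf_neq0 => t _; have := ltn_ord t => tk.
by apply: casimir_value_neq; lia.
Qed.

Lemma path_normS j k : path_norm j k.+1 = path_norm j k * (g j - g (j + k).+1).
Proof. by rewrite /path_norm big_ord_recr. Qed.

(** The projection onto the vectors of level [j] killed by [Y]. *)
Definition bottom j := P j *m E j.

Lemma bottom_mul i j : (i <= h)%N -> (j <= h)%N ->
  bottom i *m bottom j = if i == j then bottom i else 0.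
Proof.
move=> ih jh; rewrite /bottom -mulmxA (mulmxA (E i)) isotypic_level -(mulmxA (P j)).
rewrite (level_mul H) mulmxA (isotypic_mul HP) //.
by case: eqP => [->|]; rewrite ?mul0mx.
Qed.

Lemma lower_bottom j : (j <= h)%N -> Y *m bottom j = 0.
Proof.
rewrite /bottom mulmxA isotypic_lower -mulmxA.
case: j => [|j] jh; first by rewrite (lower0 H) mulmx0.
by rewrite (lowerE H) mulmxA isotypic_support ?mul0mx // leqnn.
Qed.

Lemma bottom_raise j : (j <= h)%N -> bottom j *m X = 0.
Proof.
rewrite /bottom -mulmxA; case: j => [|j] jh; first by rewrite (raise0 H) mulmx0.
by rewrite -(raiseE H) mulmxA -isotypic_raise -mulmxA isotypic_support ?mulmx0 // leqnn.
Qed.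

(** A lowest vector of level [j] is an eigenvector of the Casimir element
    for the value at [j], so every [P k] with [k != j] kills it and [P j]
    cannot. *)
Lemma bottom_neq0 j : (j <= h)%N -> bottom j != 0.
Proof.
move=> jh; have [v [v0 Ev Yv]] := lowest_vector H (ltac:(lia) : (j.*2 <= d)%N).
have Ov : Om *m v = g j *: v.
  by rewrite -{1}Ev mulmxA (casimir_low H) mulmxDl -!mulmxA Ev Yv mulmx0 add0r -scalemxAl Ev.
have Pv k : (k <= h)%N -> k != j -> P k *m v = 0.
  move=> kh kj; have : P k *m (Om *m v) = g k *: (P k *m v).
    by rewrite mulmxA -(isotypic_comm k (erefl (Om *m Om))) (isotypic_casimir HP) // scalemxAl.
  rewrite Ov -scalemxAr => /eqP; rewrite -subr_eq0 -scalerBl scaler_eq0.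
  rewrite (negPf (casimir_value_neq _ _ _)) 1?eq_sym //=; [by move/eqP|lia].
apply: contraNneq v0 => b0; rewrite -[v]mul1mx -(isotypic_sum HP) mulmx_suml.
have jh' : (j < h.+1)%N by lia.
rewrite (bigD1 (Ordinal jh')) //= -{1}Ev mulmxA -/(bottom j) b0 mul0mx add0r big1 // => k kj.
by rewrite Pv // -ltnS.
Qed.

Lemma raise_bottom_level j k : X ^+ k *m bottom j = P j *m E (j + k) *m X ^+ k.
Proof.
rewrite /bottom mulmxA -(mulmx_expr_comm _ (esym (isotypic_raise j))).
by rewrite -!mulmxA (raiseXE H).
Qed.

Lemma bottom_lower_level j k : bottom j *m Y ^+ k = P j *m Y ^+ k *m E (j + k).
Proof. by rewrite /bottom -!mulmxA (lowerXE H). Qed.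

Lemma raise_bottom_out j k : (j <= h)%N -> (d - j < j + k)%N -> X ^+ k *m bottom j = 0.
Proof. by move=> jh jk; rewrite raise_bottom_level isotypic_support ?mul0mx // jk orbT. Qed.

Lemma bottom_lower_out j k : (j <= h)%N -> (d - j < j + k)%N -> bottom j *m Y ^+ k = 0.
Proof.
move=> jh jk; rewrite bottom_lower_level (mulmx_expr_comm _ (esym (isotypic_lower j))).
by rewrite -mulmxA isotypic_support ?mulmx0 // jk orbT.
Qed.

Lemma lower_raise_bottom j k : (j <= h)%N ->
  Y *m (X ^+ k.+1 *m bottom j) = (g j - g (j + k).+1) *: (X ^+ k *m bottom j).
Proof.
move=> jh; rewrite expmxS -!mulmxA raise_bottom_level (mulmxA Y) (mulmxA (Y *m X)).
by rewrite isotypic_lower_raise // -scalemxAl.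
Qed.

Lemma lower_raiseX_bottom j k : (j <= h)%N ->
  Y ^+ k *m (X ^+ k *m bottom j) = path_norm j k *: bottom j.
Proof.
move=> jh; elim: k => [|k IH].
  by rewrite !expr0 !mul1mx /path_norm big_ord0 scale1r.
rewrite expmxSr -mulmxA lower_raise_bottom // -scalemxAr IH scalerA.
by rewrite path_normS mulrC.
Qed.

Lemma bottom_lower_raise j k : (j <= h)%N ->
  bottom j *m Y ^+ k.+1 *m X = (g j - g (j + k).+1) *: (bottom j *m Y ^+ k).
Proof.
move=> jh; rewrite expmxSr !mulmxA bottom_lower_level.
rewrite (mulmx_expr_comm _ (esym (isotypic_lower j))) -!mulmxA (mulmxA (P j)).
have -> : P j *m E (j + k) *m (Y *m X) = Y *m X *m (P j *m E (j + k)).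
  rewrite !mulmxA -(mulmxA (P j)) -(lowerE H) -(mulmxA Y) isotypic_raise.
  by rewrite (mulmxA Y) isotypic_lower -!mulmxA (raiseE H).
by rewrite isotypic_lower_raise // -scalemxAr.
Qed.

(** For a lowest vector [v] of level [j], this operator sends the vector of
    level [q] in the string [v, X v, X^2 v, ...] to the one of level [p].
    The indices [p] and [q] are levels, hence at least [j]. *)
Definition sl2_unit (j p q : nat) : 'M[R]_N :=
  (path_norm j (q - j))^-1 *: (X ^+ (p - j) *m bottom j *m Y ^+ (q - j)).
Local Notation u := sl2_unit.

Lemma sl2_unit_mul j p q k r s : (j <= h)%N -> (k <= h)%N ->
    (j <= p)%N -> (j <= q <= d - j)%N -> (k <= r)%N -> (k <= s)%N ->
  u j p q *m u k r s = if (j == k) && (q == r) then u j p s else 0.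
Proof.
move=> jh kh jp /andP[jq qj] kr ks; rewrite /u -scalemxAl -scalemxAr.
have -> : X ^+ (p - j) *m bottom j *m Y ^+ (q - j) *m
    (X ^+ (r - k) *m bottom k *m Y ^+ (s - k))
  = X ^+ (p - j) *m (bottom j *m (Y ^+ (q - j) *m (X ^+ (r - k) *m bottom k))) *m Y ^+ (s - k).
  by rewrite !mulmxA.
case: (eqVneq j k) kr ks => [<-|jk] kr ks /=; last first.
  have -> : bottom j *m (Y ^+ (q - j) *m (X ^+ (r - k) *m bottom k)) = 0.
    rewrite /bottom (mulmxA (Y ^+ _)) (mulmxA (_ *m _) (P k)).
    rewrite -mulmxA (mulmxA (E j)).
    have -> : E j *m (Y ^+ (q - j) *m X ^+ (r - k) *m P k) = P k *m (E j *m (Y ^+ (q - j) *m X ^+ (r - k))).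
      rewrite -(mulmxA (Y ^+ _)) -(mulmx_expr_comm _ (esym (isotypic_raise k))) (mulmxA (Y ^+ _)).
      by rewrite -(mulmx_expr_comm _ (esym (isotypic_lower k))) !mulmxA isotypic_level.
    by rewrite !mulmxA (isotypic_mul HP) // (negPf jk) !mul0mx.
  by rewrite mulmx0 mul0mx !scaler0.
case: eqVneq => [<-|qr].
  rewrite lower_raiseX_bottom // -!(scalemxAr, scalemxAl) bottom_mul // eqxx.
  by rewrite !scalerA mulrAC mulVf ?mul1r // path_norm_neq0 //; lia.
have -> : bottom j *m (Y ^+ (q - j) *m (X ^+ (r - j) *m bottom j)) = 0.
  rewrite mulmxA raise_bottom_level bottom_lower_level -!mulmxA (mulmxA (E _) (P j)) isotypic_level.
  rewrite -(mulmxA (P j)) (mulmxA (E _) (E _)) (level_mul H).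
  by case: eqP => [e|_]; [lia|rewrite mul0mx !mulmx0].
by rewrite mulmx0 mul0mx !scaler0.
Qed.

(** The bottom projection in the middle is pushed outward one step at a
    time; each step contributes one factor of the norm. *)
Lemma sl2_unit_diag j p : (j <= h)%N -> (j <= p <= d - j)%N -> u j p p = P j *m E p.
Proof.
move=> jh /andP[jp pj]; rewrite /u -[in RHS](subnKC jp); set k := (p - j)%N.
have jk : (j + k <= d - j)%N by rewrite /k; lia.
suff -> : X ^+ k *m bottom j *m Y ^+ k = path_norm j k *: (P j *m E (j + k)).
  by rewrite scalerA mulVf ?scale1r // path_norm_neq0.
move: k jk {jp pj}; elim=> [|k IH] jk.
  by rewrite !expr0 mulmx1 mul1mx /path_norm big_ord0 scale1r addn0.
have -> : X ^+ k.+1 *m bottom j *m Y ^+ k.+1 = X *m (X ^+ k *m bottom j *m Y ^+ k) *m Y.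
  by rewrite expmxS expmxSr !mulmxA.
rewrite IH; last by lia.
rewrite -scalemxAr -scalemxAl path_normS -scalerA; congr (_ *: _).
rewrite -!mulmxA -(lowerE H) (mulmxA (P j)) -isotypic_lower -!mulmxA.
by rewrite mulmxA isotypic_raise_lower // addnS.
Qed.

Lemma sl2_unit_sum :
  \sum_(j < h.+1) \sum_(j <= p < (d - j).+1) u j p p = 1%:M.
Proof.
rewrite -(isotypic_sum HP); apply: eq_bigr => j _.
have jh : (j <= h)%N by rewrite -ltnS.
rewrite -[RHS]mulmx1 -(level_sum H) mulmx_sumr.
rewrite -(big_mkord xpredT (fun i => P j *m E i)) /=.
rewrite [RHS](@big_cat_nat _ _ _ j) //=; last by lia.
rewrite [X in _ = _ + X](@big_cat_nat _ _ _ (d - j).+1) /=; [|lia|lia].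
have -> : \sum_(0 <= i < j) P j *m E i = 0.
  rewrite big_nat_cond; apply: big1 => i; rewrite andbT => /andP[_ ij].
  by rewrite isotypic_support ?ij.
have -> : \sum_((d - j).+1 <= i < d.+1) P j *m E i = 0.
  rewrite big_nat_cond; apply: big1 => i; rewrite andbT => /andP[ij _].
  by rewrite isotypic_support ?ij ?orbT.
by rewrite add0r addr0; apply: eq_big_nat => i ij; rewrite sl2_unit_diag.
Qed.

Lemma sl2_unit_diag_neq0 j p : (j <= h)%N -> (j <= p <= d - j)%N -> u j p p != 0.
Proof.
move=> jh jp; have := bottom_neq0 jh; apply: contraNneq => up.
have : u j j p *m u j p p *m u j p j = bottom j.
  have [jp' jj] : (j <= p)%N /\ (j <= j <= d - j)%N by lia.
  by rewrite sl2_unit_mul // !eqxx sl2_unit_mul // !eqxx /= sl2_unit_diag.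
by rewrite up mulmx0 mul0mx => <-.
Qed.

(** On the left the strings are followed without rescaling; the weights of
    the path then appear in [lower_sl2_unit], and on the right in
    [sl2_unit_lower]. *)
Lemma raise_sl2_unit j p q : (j <= p)%N -> X *m u j p q = u j p.+1 q.
Proof. by move=> jp; rewrite /u -scalemxAr subSn // expmxS !mulmxA. Qed.

Lemma lower_sl2_unit0 j q : (j <= h)%N -> Y *m u j j q = 0.
Proof.
by move=> jh; rewrite /u -scalemxAr subnn expr0 mul1mx mulmxA lower_bottom // mul0mx scaler0.
Qed.

Lemma lower_sl2_unit j p q : (j <= h)%N -> (j <= p)%N ->
  Y *m u j p.+1 q = (g j - g p.+1) *: u j p q.
Proof.
move=> jh jp; rewrite /u -scalemxAr subSn // mulmxA lower_raise_bottom // subnKC //.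
by rewrite -scalemxAl !scalerA mulrC.
Qed.

Lemma level_sl2_unit i j p q : (j <= p)%N -> E i *m u j p q = if i == p then u j p q else 0.
Proof.
move=> jp; rewrite /u -scalemxAr raise_bottom_level subnKC //.
rewrite -!mulmxA (mulmxA (E i)) isotypic_level -(mulmxA (P j) (E i)) (mulmxA (E i)) (level_mul H).
by case: eqP => [->|]; rewrite // mul0mx mulmx0 scaler0.
Qed.

Lemma sl2_unit_level i j p q : (j <= q)%N -> u j p q *m E i = if i == q then u j p q else 0.
Proof.
move=> jq; rewrite /u -scalemxAl -(mulmxA (X ^+ (p - j)) (bottom j)) bottom_lower_level subnKC //.
rewrite -!mulmxA (level_mul H) eq_sym.
by case: eqP => // _; rewrite !mulmx0 scaler0.
Qed.

Lemma sl2_unit_out j p q : (j <= h)%N -> (d - j < p)%N -> u j p q = 0.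
Proof. by move=> jh jp; rewrite /u raise_bottom_out ?mul0mx ?scaler0 //; lia. Qed.

Lemma sl2_unit_lower j p q : (j <= h)%N -> (j <= q <= d - j)%N ->
  u j p q *m Y = (g j - g q.+1) *: u j p q.+1.
Proof.
move=> jh /andP[jq qj]; rewrite /u -scalemxAl -mulmxA -expmxSr subSn // path_normS subnKC //.
case: (ltnP q (d - j)) => qd; last first.
  by rewrite -mulmxA bottom_lower_out ?mulmx0 ?scaler0 //; lia.
have gq : g j - g q.+1 != 0 by apply: casimir_value_neq; lia.
by rewrite scalerA invfM mulrCA divff // mulr1.
Qed.

Lemma sl2_unit_raise j p q : (j <= h)%N -> (j <= q < d - j)%N ->
  u j p q.+1 *m X = u j p q.
Proof.
move=> jh /andP[jq qj]; rewrite /u -scalemxAl subSn //.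
rewrite -(mulmxA (X ^+ _) (bottom j)) -(mulmxA (X ^+ _) (bottom j *m _)).
rewrite bottom_lower_raise // path_normS subnKC // -scalemxAr scalerA.
have gq : g j - g q.+1 != 0 by apply: casimir_value_neq; lia.
by rewrite invfM -mulrA mulVf // mulr1 mulmxA.
Qed.

Lemma sl2_unit_raise0 j p : (j <= h)%N -> u j p j *m X = 0.
Proof.
by move=> jh; rewrite /u -scalemxAl subnn expr0 mulmx1 -mulmxA bottom_raise // mulmx0 scaler0.
Qed.

Lemma sl2_unit_mem S : is_subalgebra S -> S X -> S Y -> (forall i, S (E i)) ->
  forall j p q, S (u j p q).
Proof.
move=> SS SX SY SE j p q; apply: (subalgZ SS).
apply: (subalgM SS); last exact: subalgX.
apply: (subalgM SS); first exact: subalgX.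
apply: (subalgM SS) => //; apply: (isotypic_mem HP SS).
apply: (subalgD SS); first exact: subalgM.
by apply: (subalg_sum SS) => i _; apply: subalgZ.
Qed.

End Sl2Units.

(** * The cube as a graded sl2-representation *)

Section WeightedMaps.
Variable R : realType.

(** Acting on a function [f] on [U], this is [x |-> c x * f (phi x)]. All
    the operators of the cube have this form, so their relations reduce to
    pointwise identities. *)
Definition wmap (T U : finType) (c : T -> R) (phi : T -> U) : 'M[R]_(#|T|, #|U|) :=
  \matrix_(x, y) (c (enum_val x) * (enum_val y == phi (enum_val x))%:R).

Lemma wmap_mulmx (T U : finType) (c : T -> R) (phi : T -> U) m (M : 'M[R]_(#|U|, m)) i j :
  (wmap c phi *m M) i j = c (enum_val i) * M (enum_rank (phi (enum_val i))) j.
Proof.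
rewrite mxE (bigD1 (enum_rank (phi (enum_val i)))) //= big1 ?addr0 => [|k ki].
  by rewrite mxE enum_rankK eqxx mulr1.
rewrite mxE; case: eqP => [ki'|]; last by rewrite mulr0 mul0r.
by case/eqP: ki; rewrite -ki' enum_valK.
Qed.

Lemma wmapM (T U V : finType) (c : T -> R) (phi : T -> U) (c' : U -> R) (psi : U -> V) :
  wmap c phi *m wmap c' psi = wmap (fun x => c x * c' (phi x)) (psi \o phi).
Proof. by apply/matrixP => i j; rewrite wmap_mulmx !mxE enum_rankK mulrA. Qed.

Lemma eq_wmap (T U : finType) (c c' : T -> R) (phi psi : T -> U) :
  (forall x, c x = c' x) -> (forall x, c x != 0 -> phi x = psi x) ->
  wmap c phi = wmap c' psi.
Proof.
move=> cc pp; apply/matrixP => i j; rewrite !mxE -cc.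
by case: (eqVneq (c (enum_val i)) 0) => [->|/pp ->]; rewrite ?mul0r.
Qed.

Lemma wmap0 (T U : finType) (phi : T -> U) : wmap (fun=> 0) phi = 0.
Proof. by apply/matrixP => i j; rewrite !mxE mul0r. Qed.

Lemma wmapB (T U : finType) (c c' : T -> R) (phi : T -> U) :
  wmap c phi - wmap c' phi = wmap (fun x => c x - c' x) phi.
Proof. by apply/matrixP => i j; rewrite !mxE mulrBl. Qed.

Lemma wmap_sum (I T U : finType) (c : I -> T -> R) (phi : T -> U) :
  \sum_i wmap (c i) phi = wmap (fun x => \sum_i c i x) phi.
Proof.
apply/matrixP => i j; rewrite summxE mxE mulr_suml.
by apply: eq_bigr => k _; rewrite mxE.
Qed.

Lemma wmapZ (T U : finType) k (c : T -> R) (phi : T -> U) :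
  k *: wmap c phi = wmap (fun x => k * c x) phi.
Proof. by apply/matrixP => i j; rewrite !mxE mulrA. Qed.

Lemma indmxE (T : finType) (P : pred T) : indmx R P = wmap (fun x => (P x)%:R) id.
Proof.
apply/matrixP => i j; rewrite !mxE (inj_eq enum_val_inj) eq_sym.
by case: eqP => _; rewrite ?mulr1 ?mulr0 //.
Qed.

Lemma wmap1 (T : finType) : wmap (fun=> 1) id = 1%:M :> 'M[R]_#|T|.
Proof. by apply/matrixP => i j; rewrite !mxE mul1r (inj_eq enum_val_inj) eq_sym. Qed.

End WeightedMaps.

Section Cube.
Variables (R : realType) (d : nat) (a : cube d).
Implicit Types (x y : cube d) (i k : 'I_d).

(** Coordinates are compared with those of the root, which turns any root
    into the origin. *)
Definition bit x i := x i != a i.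
Definition flip i x : cube d := [ffun k => if k == i then ~~ x k else x k].
Definition level x := #|[pred i | bit x i]|.

Lemma bit_flip i k x : bit (flip i x) k = (k == i) (+) bit x k.
Proof. by rewrite /bit ffunE; case: (k == i); case: (x k); case: (a k). Qed.

Lemma flipK i : involutive (flip i).
Proof. by move=> x; apply/ffunP => k; rewrite !ffunE; case: eqP => // _; rewrite negbK. Qed.

Lemma flipC i k x : flip i (flip k x) = flip k (flip i x).
Proof. by apply/ffunP => l; rewrite !ffunE; do 2!case: eqP. Qed.

Lemma level_flip i x : level (flip i x) = if bit x i then (level x).-1 else (level x).+1.
Proof.
rewrite /level (cardD1 i) [in RHS](cardD1 i) !inE bit_flip eqxx addTb.
rewrite (eq_card (B := [predD1 [pred k | bit x k] & i])); last first.
  by move=> k; rewrite !inE bit_flip; case: eqVneq.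
by case: (bit x i).
Qed.

Lemma level_flip_set i x : bit x i -> level x = (level (flip i x)).+1.
Proof.
move=> xi; rewrite level_flip xi prednK // /level (cardD1 i) inE /= xi //.
Qed.

Lemma level_flip_unset i x : ~~ bit x i -> level (flip i x) = (level x).+1.
Proof. by move=> /negPf xi; rewrite level_flip xi. Qed.

Lemma level_le x : (level x <= d)%N.
Proof. by rewrite -[X in (_ <= X)%N]card_ord; apply: max_card. Qed.

Lemma level0 x : (level x == 0%N) = (x == a).
Proof.
apply/eqP/eqP => [x0|->]; last by apply: eq_card0 => i; rewrite !inE /bit eqxx.
apply/ffunP => i; apply/eqP; have /card0_eq/(_ i) := x0.
by rewrite !inE /bit => /negbFE.
Qed.

(** The functions on the cube are the tensor power of the two-dimensional
    representation of sl2, one factor for each coordinate; these are its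
    standard operators in one factor. *)
Definition raise1 i : 'M[R]_#|cube d| := wmap (fun x => (bit x i)%:R) (flip i).
Definition lower1 i : 'M[R]_#|cube d| := wmap (fun x => (~~ bit x i)%:R) (flip i).
Definition weight1 i : 'M[R]_#|cube d| := wmap (fun x => if bit x i then -1 else 1) id.
Definition level_proj p : 'M[R]_#|cube d| := wmap (fun x => (level x == p)%:R) id.

Lemma natr_andb (b c : bool) : b%:R * c%:R = (b && c)%:R :> R.
Proof. by case: b; case: c; rewrite ?mulr1 ?mulr0. Qed.

(** Operators in different factors commute; in one factor they satisfy the
    relation of sl2. *)
Lemma lower_raise1 i k :
  lower1 k *m raise1 i = (if i == k then weight1 k else 0) + raise1 i *m lower1 k.
Proof.
apply/eqP; rewrite -subr_eq; apply/eqP; rewrite !wmapM.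
case: eqVneq => [->|ik].
  rewrite -[RHS]/(wmap _ _) (eq_wmap (c' := fun x => (~~ bit x k)%:R) (psi := id)); first last.
  - by move=> x _ /=; rewrite flipK.
  - by move=> x; rewrite natr_andb bit_flip eqxx addTb andbb.
  rewrite [X in _ - X](eq_wmap (c' := fun x => (bit x k)%:R) (psi := id)); first last.
  - by move=> x _ /=; rewrite flipK.
  - by move=> x; rewrite natr_andb bit_flip eqxx addTb negbK andbb.
  rewrite wmapB; apply: eq_wmap => // x.
  by case: (bit x k); rewrite /= ?sub0r ?subr0.
apply/eqP; rewrite subr_eq0; apply/eqP; apply: eq_wmap => x /=; last by rewrite flipC.
rewrite !natr_andb !bit_flip (negPf ik) eq_sym (negPf ik) !addFb andbC //.
Qed.

Lemma weight_raise1 i k : i != k -> weight1 k *m raise1 i = raise1 i *m weight1 k.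
Proof.
move=> ik; rewrite !wmapM; apply: eq_wmap => x //=.
by rewrite bit_flip eq_sym (negPf ik) addFb mulrC.
Qed.

Lemma raise1_level i p : raise1 i *m level_proj p = level_proj p.+1 *m raise1 i.
Proof.
rewrite !wmapM; apply: eq_wmap => x //=; rewrite !natr_andb andbC.
by case xi: (bit x i); rewrite ?andbF // (level_flip_set xi) eqSS.
Qed.

Lemma lower1_level i p : lower1 i *m level_proj p.+1 = level_proj p *m lower1 i.
Proof.
rewrite !wmapM; apply: eq_wmap => x //=; rewrite !natr_andb andbC.
by case xi: (bit x i); rewrite ?andbF // (level_flip_unset (negbT xi)) eqSS.
Qed.

Lemma raise1_level0 i : level_proj 0 *m raise1 i = 0.
Proof.
rewrite wmapM -(wmap0 R (flip i)); apply: eq_wmap => x //=; rewrite natr_andb level0.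
by case: eqP => // ->; rewrite /bit eqxx.
Qed.

Lemma lower1_level0 i : lower1 i *m level_proj 0 = 0.
Proof.
rewrite wmapM -(wmap0 R (id \o flip i)); apply: eq_wmap => x //=; rewrite natr_andb.
by case xi: (bit x i); rewrite // (level_flip_unset (negbT xi)).
Qed.

Definition raise := \sum_i raise1 i.
Definition lower := \sum_i lower1 i.

Lemma sum_levels (f : nat -> R) x : \sum_(p < d.+1) f p * (level x == p :> nat)%:R = f (level x).
Proof.
have xd : (level x < d.+1)%N by rewrite ltnS level_le.
rewrite (bigD1 (Ordinal xd)) //= eqxx mulr1 big1 ?addr0 // => p px.
case: eqP => [xp|]; rewrite ?mulr0 //.
by case/eqP: px; apply: val_inj.
Qed.

Lemma sum_weight1 : \sum_k weight1 k = \sum_(p < d.+1) (d%:R - p%:R *+ 2) *: level_proj p.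
Proof.
rewrite /weight1 /level_proj; under [RHS]eq_bigr do rewrite wmapZ.
rewrite wmap_sum wmap_sum; apply: eq_wmap => // x.
rewrite (sum_levels (fun p => d%:R - p%:R *+ 2)).
rewrite (eq_bigr (fun k => 1 - (bit x k)%:R *+ 2)); last first.
  by move=> k _; case: (bit x k); rewrite /= ?subr0 //; ring.
rewrite sumrB sumr_const card_ord sumrMnl -natr_sum /level -sum1_card [in RHS]big_mkcond /=.
by congr (_ - _%:R *+ _); apply: eq_bigr => k _; case: (bit x k).
Qed.

Lemma cube_sl2_comm :
  lower *m raise - raise *m lower = \sum_(p < d.+1) (d%:R - p%:R *+ 2) *: level_proj p.
Proof.
rewrite -sum_weight1 mulmx_suml mulmx_suml [X in _ - X](eq_bigr _ (fun i _ => mulmx_sumr _ _ _ _)).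
rewrite [X in _ - X]exchange_big /= -sumrB; apply: eq_bigr => k _.
rewrite mulmx_sumr -sumrB (bigD1 k) //= big1 ?addr0 => [|i ik].
  by rewrite lower_raise1 eqxx addrK.
by rewrite lower_raise1 (negPf ik) add0r subrr.
Qed.

(** The vector is a tensor product of [j] alternating vectors, each in two
    factors, with the bottom vector in the remaining factors. The last
    condition, that the factors from [2j] on are at the bottom, is what the
    construction of the next vector uses. *)
Lemma cube_lowest_vector j : (j.*2 <= d)%N ->
  exists v : 'cV[R]_#|cube d|,
    [/\ v != 0, level_proj j *m v = v, lower *m v = 0 &
     forall i : 'I_d, (j.*2 <= i)%N -> lower1 i *m v = 0 /\ weight1 i *m v = v].
Proof.
elim: j => [|j IH] jd.
  exists (\col_x (enum_val x == a)%:R).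
  have pt i x : bit x i -> (x == a) = false.
    by move=> xi; apply/eqP => xa; rewrite xa /bit eqxx in xi.
  split=> [|||i _].
  - apply/eqP => /matrixP/(_ (enum_rank a) 0)/eqP; rewrite !mxE enum_rankK eqxx.
    by rewrite oner_eq0.
  - apply/matrixP => x y; rewrite wmap_mulmx !mxE enum_rankK level0.
    by case: eqP; rewrite ?mulr1 ?mulr0.
  - rewrite mulmx_suml big1 // => i _; apply/matrixP => x y.
    rewrite wmap_mulmx !mxE enum_rankK.
    case xi: (bit (enum_val x) i); rewrite ?mul0r //.
    by rewrite (pt i) ?mulr0 // bit_flip eqxx xi.
  - split; apply/matrixP => x y; rewrite wmap_mulmx !mxE enum_rankK.
      case xi: (bit (enum_val x) i); rewrite ?mul0r //.
      by rewrite (pt i) ?mulr0 // bit_flip eqxx xi.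
    case xi: (bit (enum_val x) i); last by rewrite mul1r.
    by rewrite (pt i _ xi) mulr0.
have [|v [v0 Ev Yv vi]] := IH; first by lia.
have sd : (j.*2 < d)%N by lia.
have td : (j.*2.+1 < d)%N by lia.
pose s := Ordinal sd; pose t := Ordinal td.
have st : s != t by rewrite -val_eqE /=; lia.
have [[ls hs] [lt ht]] : (lower1 s *m v = 0 /\ weight1 s *m v = v) /\
    (lower1 t *m v = 0 /\ weight1 t *m v = v) by split; apply: vi => /=; lia.
have Yr i : weight1 i *m v = v -> lower *m (raise1 i *m v) = v.
  move=> hi; rewrite mulmxA mulmx_suml (eq_bigr _ (fun k _ => lower_raise1 i k)).
  rewrite big_split /= -mulmx_sumr mulmxDl -mulmxA Yv mulmx0 addr0.
  by rewrite (bigD1 i) //= eqxx big1 ?addr0 // => k /negPf ki; rewrite eq_sym ki.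
exists (raise1 s *m v - raise1 t *m v); split.
- have : lower1 s *m (raise1 s *m v - raise1 t *m v) = v.
    rewrite mulmxBr !mulmxA !lower_raise1 eqxx eq_sym (negPf st) add0r mulmxDl.
    by rewrite -!mulmxA ls !mulmx0 hs addr0 subr0.
  by apply: contra_eq_neq => ->; rewrite mulmx0 eq_sym.
- by rewrite mulmxBr !mulmxA -!raise1_level -!mulmxA Ev.
- by rewrite mulmxBr !Yr // subrr.
- move=> i ij.
  have is_ : (i == s) = false by apply/eqP => e; move: ij; rewrite e /=; lia.
  have it_ : (i == t) = false by apply/eqP => e; move: ij; rewrite e /=; lia.
  have [li hi] := vi i (ltac:(lia)).
  split; rewrite mulmxBr !mulmxA.
    rewrite !lower_raise1 ![_ == i]eq_sym is_ it_ !add0r -!mulmxA li !mulmx0 subrr //.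
  by rewrite !weight_raise1 1?eq_sym ?is_ ?it_ // -!mulmxA hi.
Qed.

Lemma cube_graded_sl2 : graded_sl2 d raise lower level_proj.
Proof.
split.
- move=> p q; rewrite wmapM.
  case: eqVneq => [->|pq]; first by apply: eq_wmap => x //=; rewrite natr_andb andbb.
  rewrite -(wmap0 R (id \o id)); apply: eq_wmap => x //=; rewrite natr_andb.
  by case: eqP => // ->; rewrite (negPf pq).
- rewrite -wmap1 wmap_sum; apply: eq_wmap => // x.
  by rewrite -[RHS](sum_levels (fun=> 1) x); apply: eq_bigr => p _; rewrite mul1r.
- by move=> p; rewrite mulmx_suml mulmx_sumr; apply: eq_bigr => i _; exact: raise1_level.
- by rewrite mulmx_sumr big1 // => i _; exact: raise1_level0.
- by move=> p; rewrite mulmx_suml mulmx_sumr; apply: eq_bigr => i _; exact: lower1_level.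
- by rewrite mulmx_suml big1 // => i _; exact: lower1_level0.
- exact: cube_sl2_comm.
- by move=> j /cube_lowest_vector [v [v0 Ev Yv _]]; exists v.
Qed.

(** Flipping a coordinate raises or lowers the level, according to the value
    of that bit. *)
Lemma adjmx_cube : adjmx R (@cube_adj d) = raise + lower.
Proof.
rewrite /raise /lower -big_split /=; apply/matrixP => x y; rewrite summxE mxE.
set X := enum_val x; set Y := enum_val y.
rewrite (eq_bigr (fun i => (Y == flip i X)%:R)); last first.
  move=> i _; rewrite !mxE -mulrDl -/X -/Y.
  by case: (bit X i); rewrite /= ?add0r ?addr0 mul1r.
have flip_eq i : (Y == flip i X) = ([pred k | X k != Y k] =i pred1 i :> Prop) :> Prop.
  apply/propext; split=> [/eqP -> k|XY].
    by rewrite !inE ffunE; case: (k == i); case: (X k).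
  apply/eqP/ffunP => k; move: (XY k); rewrite !inE ffunE.
  by case: (k == i); case: (X k); case: (Y k).
rewrite /cube_adj; case: card1P => [[i iXY]|XY].
  rewrite (bigD1 i) //= big1 ?addr0 => [|k ki].
    by have -> : Y == flip i X by rewrite flip_eq.
  case: (boolP (Y == flip k X)) => //; rewrite flip_eq => /(_ k).
  by rewrite iXY !inE eqxx (negPf ki).
rewrite big1 // => i _; case: (boolP (Y == flip i X)) => //; rewrite flip_eq => iXY.
by case: XY; exists i.
Qed.

(** One step changes the level by one, so the level bounds the length of a
    walk from the root from below. *)
Lemma walk_level x s : path (@cube_adj d) x s -> (level (last x s) <= level x + size s)%N.
Proof.
elim: s x => [|y s IH] x /=; first by rewrite addn0.
move=> /andP[/card1P[i xy] /IH] /leq_trans; apply.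
suff -> : y = flip i x.
  by rewrite level_flip; move: (level x) (size s) => n m; case: ifP => _; lia.
apply/ffunP => k; move: (xy k); rewrite !inE ffunE.
by case: (k == i); case: (x k); case: (y k).
Qed.

Lemma walk_to x : exists2 s, size s = level x & path (@cube_adj d) a s && (last a s == x).
Proof.
move: {-1}(level x) (erefl (level x)) => n; elim: n x => [|n IH] x xn.
  by exists [::] => //=; rewrite eq_sym -level0 xn.
have /card_gt0P [i] : (0 < level x)%N by rewrite xn.
rewrite inE => xi; have := level_flip_set xi; rewrite xn => -[/esym/IH[s sn /andP[ps /eqP ls]]].
exists (rcons s x); first by rewrite size_rcons sn.
rewrite rcons_path last_rcons eqxx ps ls andbT /=; apply/card1P; exists i => k.
by rewrite !inE ffunE; case: (k == i); case: (x k).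
Qed.

Lemma gdist_level x : gdist (@cube_adj d) a x = level x.
Proof.
rewrite /gdist; set p : nat -> bool := (X in find X _).
have px : p (level x).
  have [s sn sP] := walk_to x; apply/existsP.
  by exists (tcast sn (in_tuple s)); rewrite val_tcast.
(* No walk is shorter than the level. *)
have lx n : p n -> (level x <= n)%N.
  move=> /existsP[s /andP[ps /eqP <-]]; apply: leq_trans (walk_level ps) _.
  by rewrite size_tuple (eqP (_ : level a == 0%N)) ?level0.
have xV : (level x < #|cube d|)%N.
  rewrite card_ffun card_bool card_ord; apply: leq_ltn_trans (level_le x) _.
  exact: ltn_expl.
have hp : has p (iota 0 #|cube d|) by apply/hasP; exists (level x); rewrite ?mem_iota.
have fV : (find p (iota 0 #|cube d|) < #|cube d|)%N.
  by move: hp; rewrite has_find size_iota.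
apply/eqP; rewrite eqn_leq; apply/andP; split; last first.
  by apply: lx; have := nth_find 0%N hp; rewrite nth_iota.
rewrite leqNgt; apply/negP => /(before_find 0%N).
by rewrite nth_iota // add0n px.
Qed.

Lemma dual_idem_cube p : dual_idem R (@cube_adj d) a p = level_proj p.
Proof.
by rewrite /dual_idem indmxE; apply: eq_wmap => x //; rewrite gdist_level.
Qed.

Local Notation T := (terwilliger R (@cube_adj d) a).

Lemma terwilliger_level p : T (level_proj p).
Proof.
case: (leqP p (eccentricity (@cube_adj d) a)) => pe.
  by apply: gen_alg_incl; right; exists p => //; rewrite dual_idem_cube.
rewrite (_ : level_proj p = 0); first exact: (subalg0 (gen_alg_subalgebra _)).
rewrite -(wmap0 R id); apply: eq_wmap => // x; case: eqP => // xp.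
have := leq_bigmax (F := gdist (@cube_adj d) a) x; rewrite -/(eccentricity _ _).
by rewrite gdist_level xp leqNgt pe.
Qed.

Let H := cube_graded_sl2.

(** The part of [raise] that starts on level [p] is cut out of the adjacency
    matrix by two level projections, since the part that goes down ends on
    another level. *)
Lemma raise_levels : raise = \sum_(p < d.+1) level_proj p.+1 *m (raise + lower) *m level_proj p.
Proof.
rewrite -[LHS]mulmx1 -(level_sum H) mulmx_sumr; apply: eq_bigr => p _.
rewrite mulmxDr mulmxDl -(raiseE H) -mulmxA (level_mul H) eqxx.
case: (nat_of_ord p) => [|q]; first by rewrite -!mulmxA (lower0 H) mulmx0 addr0.
by rewrite -!mulmxA (lowerE H) mulmxA (level_mul H) gtn_eqF // mul0mx addr0.
Qed.

Lemma terwilliger_raise : T raise.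
Proof.
have SS : is_subalgebra T := gen_alg_subalgebra _.
rewrite raise_levels; apply: (subalg_sum SS) => p _.
apply: (subalgM SS); last exact: terwilliger_level.
apply: (subalgM SS); first exact: terwilliger_level.
by rewrite -adjmx_cube; apply: gen_alg_incl; left.
Qed.

Lemma terwilliger_lower : T lower.
Proof.
rewrite -[lower](addKr raise) addrC.
apply: (subalgB (gen_alg_subalgebra _)); last exact: terwilliger_raise.
by rewrite -adjmx_cube; apply: gen_alg_incl; left.
Qed.

End Cube.

(** * Removal of the root *)

(** The part of lowest level 0 loses its bottom vector, the root; the other
    parts vanish at the root and keep all their levels. *)
Definition path_start (j : nat) : nat := maxn 1 j.
Definition path_size (d j : nat) : nat := (d - j).+1 - path_start j.
Definition path_weight (R : realType) (d j p : nat) : R :=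
  casimir_value R d j - casimir_value R d (path_start j + p).

(** The common form of both algebras after the removal of the root: matrix
    units of blocks [j], in which [B] acts as a path with weights
    [path_weight d j] and [F] marks the first vertex of the blocks 0 and 1. *)
Record path_units (R : realType) (N d : nat) (B F : 'M[R]_N) (w : nat -> nat -> nat -> 'M[R]_N) : Prop :=
  PathUnits {
  path_matrix_units : matrix_units (fun j : 'I_(d %/ 2)%N.+1 => path_size d j) (fun j : 'I_(d %/ 2)%N.+1 => w j);
  path_out : forall j p q, (j <= (d %/ 2)%N)%N -> (path_size d j <= p)%N -> w j p q = 0;
  path_adj0 : forall j q, (j <= (d %/ 2)%N)%N -> B *m w j 0 q = w j 1 q;
  path_adjS : forall j p q, (j <= (d %/ 2)%N)%N ->
    B *m w j p.+1 q = w j p.+2 q + path_weight R d j p.+1 *: w j p q;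
  path_radj0 : forall j p, (j <= (d %/ 2)%N)%N -> w j p 0 *m B = path_weight R d j 1 *: w j p 1;
  path_radjS : forall j p q, (j <= (d %/ 2)%N)%N -> (q.+1 < path_size d j)%N ->
    w j p q.+1 *m B = path_weight R d j q.+2 *: w j p q.+2 + w j p q;
  path_mark : forall j p q, (j <= (d %/ 2)%N)%N ->
    F *m w j p q = if (j <= 1)%N && (p == 0)%N then w j p q else 0 }.

Section Residual.
Variables (R : realType) (d : nat) (a : cube d).
Hypothesis d_gt0 : (0 < d)%N.
Local Notation h := (d %/ 2)%N.
Local Notation E := (level_proj R a).
Local Notation X := (raise R a).
Local Notation Y := (lower R a).
Local Notation V' := (residual a).
Local Notation T := (terwilliger R (@cube_adj d) a).
Let H : graded_sl2 d X Y E := cube_graded_sl2 R a.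

(** Restriction of functions to the residual vertices. *)
Definition extract : 'M[R]_(#|V'|, #|cube d|) := wmap (fun=> 1) val.
Local Notation J := extract.

Lemma extract_mulmx m (M : 'M[R]_(#|cube d|, m)) i j :
  (J *m M) i j = M (enum_rank (val (enum_val i))) j.
Proof. by rewrite wmap_mulmx mul1r. Qed.

Lemma mulmx_trextract m (M : 'M[R]_(m, #|cube d|)) i j :
  (M *m J^T) i j = M i (enum_rank (val (enum_val j))).
Proof. by rewrite -[M]trmxK -trmx_mul mxE extract_mulmx [RHS]mxE. Qed.

Lemma extractK : J *m J^T = 1%:M.
Proof.
apply/matrixP => i j; rewrite mulmx_trextract !mxE mul1r enum_rankK.
by rewrite (inj_eq val_inj) (inj_eq enum_val_inj) eq_sym.
Qed.

Lemma trextractK : J^T *m J = 1%:M - E 0.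
Proof.
rewrite -wmap1 wmapB; apply/matrixP => i j; rewrite mxE [RHS]mxE level0.
case: (eqVneq (enum_val i) a) => [ia|ia] /=.
  rewrite subrr mul0r big1 // => k _; rewrite !mxE ia mul1r.
  by rewrite eq_sym (negPf (valP (enum_val k))) mul0r.
rewrite subr0 mul1r (bigD1 (enum_rank (Sub (enum_val i) ia : V'))) //= big1 ?addr0 => [|k].
  by rewrite !mxE enum_rankK /= eqxx !mul1r.
move=> ki; rewrite !mxE !mul1r; case: eqP => [e|]; last by rewrite mul0r.
case/eqP: ki; rewrite -[k]enum_valK; congr enum_rank; apply: val_inj.
by rewrite -e.
Qed.

Lemma extract_root : J *m E 0 = 0.
Proof.
have : J *m (J^T *m J) = J by rewrite mulmxA extractK mul1mx.
by rewrite trextractK mulmxBr mulmx1 => /eqP; rewrite subr_eq addrC -subr_eq subrr => /eqP.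
Qed.

Lemma root_trextract : E 0 *m J^T = 0.
Proof.
have : J^T *m J *m J^T = J^T by rewrite -mulmxA extractK mulmx1.
by rewrite trextractK mulmxBl mul1mx => /eqP; rewrite subr_eq addrC -subr_eq subrr => /eqP.
Qed.

Lemma to_residualE M : to_residual a M = J *m M *m J^T.
Proof. by apply/matrixP => i j; rewrite mulmx_trextract extract_mulmx mxE. Qed.

Lemma off_rootE : off_root R (@cube_adj d) a = 1%:M - E 0.
Proof. by rewrite /off_root dual_idem_cube. Qed.

(** Restriction already discards the row and the column of the root. *)
Lemma cornerE M : to_residual a (off_root R (@cube_adj d) a *m M *m off_root R (@cube_adj d) a) = J *m M *m J^T.
Proof.
have Je : J *m (1%:M - E 0) = J by rewrite mulmxBr mulmx1 extract_root subr0.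
have eJ : (1%:M - E 0) *m J^T = J^T by rewrite mulmxBl mul1mx root_trextract subr0.
by rewrite to_residualE off_rootE !mulmxA Je -mulmxA eJ.
Qed.

Lemma residual_adj : adjmx R (@del_adj _ (@cube_adj d) a) = J *m (X + Y) *m J^T.
Proof.
by rewrite -adjmx_cube; apply/matrixP => i j; rewrite mulmx_trextract extract_mulmx !mxE !enum_rankK.
Qed.

Lemma residual_mark : indmx R (fun x : V' => cube_adj a (val x)) = J *m E 1 *m J^T.
Proof.
apply/matrixP => i j; rewrite mulmx_trextract extract_mulmx !mxE !enum_rankK.
rewrite (inj_eq val_inj) (inj_eq enum_val_inj) eq_sym -mulnb natrM mulrC.
congr (_%:R * _); congr (nat_of_bool (_ == _)); apply: eq_card => k.
by rewrite !inE /bit eq_sym.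
Qed.

Variable P : nat -> 'M[R]_#|cube d|.
Hypothesis HP : isotypic d X Y E P.
Local Notation u := (sl2_unit d X Y E P).
Local Notation lo := path_start.
Local Notation n := (path_size d).
Local Notation g := (casimir_value R d).

Definition residual_unit j p q : 'M[R]_#|V'| := J *m u j (lo j + p) (lo j + q) *m J^T.
Local Notation w := residual_unit.

Lemma start_ge j : (j <= lo j)%N. Proof. exact: leq_maxr. Qed.
Lemma start_gt0 j : (0 < lo j)%N. Proof. exact: leq_maxl. Qed.

Lemma trextract_unit j p q : J^T *m w j p q = u j (lo j + p) (lo j + q) *m J^T.
Proof.
rewrite /w !mulmxA trextractK mulmxBl mul1mx (level_sl2_unit H HP); last first.
  by rewrite (leq_trans (start_ge j)) ?leq_addr.
by rewrite ltn_eqF ?subr0 // ltn_addr ?start_gt0.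
Qed.

Lemma unit_extract j p q : w j p q *m J = J *m u j (lo j + p) (lo j + q).
Proof.
rewrite /w -!mulmxA trextractK mulmxBr mulmx1 (sl2_unit_level H); last first.
  by rewrite (leq_trans (start_ge j)) ?leq_addr.
by rewrite ltn_eqF ?subr0 // ltn_addr ?start_gt0.
Qed.

Lemma size_range j p : (j <= h)%N -> (p < n j)%N -> (j <= lo j + p <= d - j)%N.
Proof. by rewrite /n /path_size /lo; lia. Qed.

Lemma start_range j : (j <= h)%N -> (lo j <= d - j)%N.
Proof. by rewrite /lo; lia. Qed.

(** Restriction and extension by zero are inverse to each other off level 0,
    so the relations of the units on the whole cube carry over, the only
    loss being the terms on level 0. *)
Lemma residual_path_units :
  path_units d (J *m (X + Y) *m J^T) (J *m E 1 *m J^T) w.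
Proof.
have jl j p : (j <= lo j + p)%N by rewrite (leq_trans (start_ge j)) ?leq_addr.
split.
- split=> [j p q k r s pj qj rk sk||j p pj].
  + have jh : (j <= h)%N by rewrite -ltnS.
    have kh : (k <= h)%N by rewrite -ltnS.
    rewrite {2}/w !mulmxA unit_extract -(mulmxA J) (sl2_unit_mul H HP) ?size_range ?jl //.
    rewrite val_eqE; case: eqVneq => [->|jk] /=; last by rewrite mulmx0 mul0mx.
    by rewrite eqn_add2l; case: eqP => // _; rewrite mulmx0 mul0mx.
  + rewrite -extractK -{1}[J]mulmx1 -(sl2_unit_sum H HP) mulmx_sumr mulmx_suml.
    apply: eq_bigr => j _; have jh : (j <= h)%N by rewrite -ltnS.
    have -> : \sum_(j <= p < (d - j).+1) u j p p = (if j == 0 :> nat then u 0 0 0 else 0)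
       + \sum_(lo j <= p < (d - j).+1) u j p p.
      rewrite /lo; case: (nat_of_ord j) jh => [|i] ih /=; last by rewrite add0r maxnSS max0n.
      by rewrite subn0 big_ltn.
    rewrite mulmxDr mulmxDl [X in X + _](_ : _ = 0) ?add0r; last first.
      case: eqP => _; rewrite ?mulmx0 ?mul0mx //.
      have -> : u 0 0 0 = E 0 *m u 0 0 0 by rewrite (level_sl2_unit H HP).
      by rewrite mulmxA extract_root !mul0mx.
    rewrite -{1}[lo j]add0n big_addn big_mkord mulmx_sumr mulmx_suml.
    by apply: eq_bigr => p _; rewrite /w addnC.
  + have jh : (j <= h)%N by rewrite -ltnS.
    have u0 := sl2_unit_diag_neq0 H HP jh (size_range jh pj).
    apply: contraNneq u0 => w0; have := trextract_unit j p p; rewrite w0 mulmx0 => uJ.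
    have : u j (lo j + p) (lo j + p) *m (1%:M - E 0) = 0.
      by rewrite -trextractK mulmxA -uJ mul0mx.
    rewrite mulmxBr mulmx1 (sl2_unit_level H) ?jl // ltn_eqF ?subr0 ?ltn_addr ?start_gt0 //.
    by move=> ->.
- move=> j p q jh np; rewrite /w (sl2_unit_out H HP) ?mulmx0 ?mul0mx //.
  by move: np; rewrite /n /path_size /lo; lia.
- move=> j q jh; rewrite -mulmxA trextract_unit -mulmxA (mulmxA (X + Y)) mulmxDl.
  rewrite raise_sl2_unit ?jl // mulmxDl mulmxDr -addnS.
  rewrite [X in _ + X](_ : _ = 0) ?addr0 ?mulmxA //.
  rewrite addn0 /lo; case: j jh => [|j] jh; last first.
    by rewrite maxnSS max0n -(mulmxA J) (lower_sl2_unit0 H HP) // mulmx0 mul0mx.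
  rewrite maxn0 -(mulmxA J) (lower_sl2_unit H HP) // -scalemxAr -scalemxAl.
  have -> : u 0 0 (1 + q) = E 0 *m u 0 0 (1 + q) by rewrite (level_sl2_unit H HP).
  by rewrite !mulmxA extract_root !mul0mx scaler0.
- move=> j p q jh; rewrite -mulmxA trextract_unit -mulmxA (mulmxA (X + Y)) mulmxDl.
  rewrite raise_sl2_unit ?jl // mulmxDl mulmxDr -addnS.
  rewrite [in X in _ + X = _]addnS (lower_sl2_unit H HP) ?jl // -scalemxAl -scalemxAr.
  by rewrite /w /path_weight !addnS !mulmxA.
- move=> j p jh; rewrite !mulmxA unit_extract -(mulmxA J) mulmxDr addn0.
  rewrite [X in _ *m (_ + X)](sl2_unit_lower H HP) //; last by rewrite start_ge start_range.
  rewrite mulmxDr mulmxDl -(scalemxAr (_ - _)) -(scalemxAl (_ - _)).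
  rewrite [X in X + _](_ : _ = 0) ?add0r; first by rewrite /w /path_weight addn1.
  rewrite /lo; case: j jh => [|j] jh; last first.
    by rewrite maxnSS max0n (sl2_unit_raise0 H HP) // mulmx0 mul0mx.
  rewrite maxn0 (sl2_unit_raise H HP) //; last by lia.
  have -> : u 0 (1 + p) 0 = u 0 (1 + p) 0 *m E 0 by rewrite (sl2_unit_level H).
  by rewrite -!mulmxA root_trextract !mulmx0.
- move=> j p q jh qn; rewrite !mulmxA unit_extract -(mulmxA J) mulmxDr.
  have qr := size_range jh qn; have qr' := jl j q.
  rewrite [X in _ *m (_ + X)](sl2_unit_lower H HP) // addnS (sl2_unit_raise H HP) //; last first.
    by move: qr qr'; rewrite addnS; lia.
  rewrite mulmxDr mulmxDl -(scalemxAr (_ - _)) -(scalemxAl (_ - _)) addrC /w /path_weight !addnS.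
  by [].
- move=> j p q jh; rewrite -mulmxA trextract_unit -mulmxA (mulmxA (E 1)).
  rewrite (level_sl2_unit H HP) ?jl //.
  have -> : (1 == lo j + p)%N = (j <= 1)%N && (p == 0%N) by rewrite /lo; lia.
  by case: ifP => _; rewrite ?mul0mx ?mulmx0 // mulmxA.
Qed.

(** The generators map each unit to a combination of units: the adjacency
    matrix moves along the strings and the level projections are diagonal. *)
Lemma terwilliger_span :
  (T `<=` units_span (fun j : 'I_h.+1 => ((d - j).+1 - j)%N) (fun (j : 'I_h.+1) p q => u j (j + p) (j + q)))%classic.
Proof.
set n' := fun j : 'I_h.+1 => _; set u' := fun (j : 'I_h.+1) => _.
have jhP (j : 'I_h.+1) : (j <= h)%N by rewrite -ltnS.
have rng (j : 'I_h.+1) p : (p < n' j)%N -> (j <= j + p <= d - j)%N.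
  by have := jhP j; rewrite /n'; lia.
have U : matrix_units n' u'.
  split=> [j p q k r s pj qj rk sk||j p pj].
  + rewrite /u' (sl2_unit_mul H HP) ?jhP ?rng ?leq_addr //.
    by rewrite val_eqE; case: eqVneq => [->|//] /=; rewrite eqn_add2l.
  + rewrite -(sl2_unit_sum H HP); apply: eq_bigr => j _.
    rewrite -[RHS]/(\sum_(0 + j <= p < (d - j).+1) u j p p) big_addn big_mkord; apply: eq_bigr => p _.
    by rewrite /u' addnC.
  + by apply: (sl2_unit_diag_neq0 H HP); rewrite ?jhP ?rng.
have SS := units_span_subalgebra U.
have Su (j : 'I_h.+1) p q : (j <= p)%N -> (j <= q <= d - j)%N -> units_span n' u' (u j p q).
  move=> jp jq; case: (leqP p (d - j)) => pj; last first.
    by rewrite (sl2_unit_out H HP) ?jhP //; exact: subalg0.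
  have := @units_span_unit _ _ _ _ _ U j (p - j) (q - j); rewrite /u' !subnKC //; last by case/andP: jq.
  by apply; rewrite /n'; lia.
apply: gen_alg_min => // M [->|[i _ <-]]; apply: (units_span_left U) => j p pn.
- rewrite (adjmx_cube R a) mulmxDl /u'; have := rng _ _ pn => /andP[jp pj]; apply: (subalgD SS).
    by rewrite raise_sl2_unit //; apply: Su; rewrite ?jp // leqW.
  move: (j + p)%N jp pj => m; rewrite leq_eqVlt => /orP[/eqP <-|jm] pj.
    by rewrite (lower_sl2_unit0 H HP) ?jhP //; exact: subalg0.
  case: m jm pj => [//|m] jm pj.
  rewrite (lower_sl2_unit H HP) ?jhP //; apply: (subalgZ SS); apply: Su => //.
  by rewrite ltnW.
- rewrite dual_idem_cube /u' (level_sl2_unit H HP) ?leq_addr //.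
  case: eqP => _; last exact: subalg0.
  by have rp := rng _ _ pn; apply: Su => //; case/andP: rp.
Qed.

(** Among the units of the Terwilliger algebra, those that involve level 0
    are lost and the others become the units of the residual system. *)
Lemma corner_span :
  corner R (@cube_adj d) a = units_span (fun j : 'I_h.+1 => n j) (fun j : 'I_h.+1 => w j).
Proof.
have U := path_matrix_units residual_path_units.
have SS := units_span_subalgebra U.
apply/seteqP; split=> [_ [M TM <-]|_ [x _ <-]].
  rewrite cornerE; have [x _ <-] := terwilliger_span TM.
  rewrite /units_map mulmx_sumr mulmx_suml; apply: (subalg_sum SS) => j _.
  have jh : (j <= h)%N by rewrite -ltnS.
  rewrite mulmx_sumr mulmx_suml; apply: (subalg_sum SS) => p _.
  rewrite mulmx_sumr mulmx_suml; apply: (subalg_sum SS) => q _.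
  rewrite -scalemxAr -scalemxAl; apply: (subalgZ SS).
  have pj := ltn_ord p; have qj := ltn_ord q.
  case: (posnP (j + p)) => [p0|p0].
    have -> : u j (j + p) (j + q) = E 0 *m u j (j + p) (j + q).
      by rewrite (level_sl2_unit H HP) ?leq_addr // p0.
    by rewrite mulmxA extract_root !mul0mx; exact: subalg0.
  case: (posnP (j + q)) => [q0|q0].
    have -> : u j (j + p) (j + q) = u j (j + p) (j + q) *m E 0.
      by rewrite (sl2_unit_level H) ?leq_addr // q0.
    by rewrite -!mulmxA root_trextract !mulmx0; exact: subalg0.
  have -> : J *m u j (j + p) (j + q) *m J^T = w j (j + p - lo j) (j + q - lo j).
    by rewrite /w !subnKC // /lo; lia.
  by apply: (units_span_unit U); rewrite /n /path_size /lo; lia.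
exists (\sum_(j < h.+1) \sum_(p < n j) \sum_(q < n j) x j p q *: u j (lo j + p) (lo j + q)).
  have TT : is_subalgebra T := gen_alg_subalgebra _.
  do 3![apply: (subalg_sum TT) => ? _]; apply: (subalgZ TT).
  apply: (sl2_unit_mem HP TT); [exact: terwilliger_raise|exact: terwilliger_lower|exact: terwilliger_level].
rewrite cornerE mulmx_sumr mulmx_suml; apply: eq_bigr => j _.
rewrite mulmx_sumr mulmx_suml; apply: eq_bigr => p _.
rewrite mulmx_sumr mulmx_suml; apply: eq_bigr => q _.
by rewrite -scalemxAr -scalemxAl.
Qed.

End Residual.

(** * Eigenvectors of the Sylvester-Kac matrix *)

Section Kravchuk.
Variable R : realType.

(** Its coefficients are the values of the Krawtchouk polynomials. These
    polynomials in [X] are eigenvectors of the operator [q |-> m X q + (1 -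
    X^2) q'], whose matrix in the monomials is the Sylvester-Kac matrix. *)
Definition kravchuk (m i : nat) : {poly R} := (1 - 'X) ^+ i * (1 + 'X) ^+ (m - i).

Lemma kravchuk_ode m i : (i <= m)%N ->
  m%:R *: 'X * kravchuk m i + (1 - 'X ^+ 2) * (kravchuk m i)^`()
    = (m%:R - i%:R *+ 2) *: kravchuk m i.
Proof.
move=> im; rewrite /kravchuk derivM !deriv_exp !derivE.
set P := 1 - 'X; set Q := 1 + 'X; set k := (m - i)%N.
have -> : m = (k + i)%N by rewrite /k subnK.
have PP : P * (P ^+ i.-1 *+ i) = P ^+ i *+ i.
  by case: (i) => [|l]; rewrite ?mulr0n ?mulr0 // mulrnAr -exprS.
have QQ : Q * (Q ^+ k.-1 *+ k) = Q ^+ k *+ k.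
  by case: (k) => [|l]; rewrite ?mulr0n ?mulr0 // mulrnAr -exprS.
have -> : 1 - 'X ^+ 2 = P * Q :> {poly R} by rewrite /P /Q; ring.
rewrite -!mul_polyC rmorphB rmorphMn /= !polyC_natr natrD.
have -> : P * Q * ((0 - 1) * P ^+ i.-1 *+ i * Q ^+ k + P ^+ i * ((0 + 1) * Q ^+ k.-1 *+ k))
  = - (P * (P ^+ i.-1 *+ i)) * (Q * Q ^+ k) + (Q * (Q ^+ k.-1 *+ k)) * (P * P ^+ i).
  ring.
rewrite PP QQ -(mulr_natr (P ^+ i)) -(mulr_natr (Q ^+ k)) /P /Q.
ring.
Qed.

Lemma kravchuk_rec m i p : (i <= m)%N ->
  (m%:R - p%:R) * (kravchuk m i)`_p + p.+2%:R * (kravchuk m i)`_p.+2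
    = (m%:R - i%:R *+ 2) * (kravchuk m i)`_p.+1.
Proof.
move=> im; have := congr1 (fun q : {poly R} => q`_p.+1) (kravchuk_ode im).
rewrite coefD -scalerAl !coefZ coefXM /= mulrBl mul1r coefB.
rewrite expr2 -mulrA !coefXM /= => <-; rewrite !coef_deriv.
case: p => [|p] /=; first by ring.
by rewrite -[_ *+ p.+3]mulr_natl -[_ *+ p.+1]mulr_natl; ring.
Qed.

Lemma kravchuk_rec0 m i : (i <= m)%N ->
  (kravchuk m i)`_1 = (m%:R - i%:R *+ 2) * (kravchuk m i)`_0.
Proof.
move=> im; have := congr1 (fun q : {poly R} => q`_0) (kravchuk_ode im).
rewrite coefD -scalerAl !coefZ coefXM /= mulrBl mul1r coefB.
by rewrite expr2 -mulrA !coefXM /= => <-; rewrite coef_deriv mulr0 add0r subr0 mulr1n.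
Qed.

Lemma kravchuk_coef0 m i : (kravchuk m i)`_0 = 1.
Proof.
rewrite -horner_coef0 /kravchuk hornerM !horner_exp !hornerE.
by rewrite ?subr0 ?addr0 !expr1n ?mulr1.
Qed.

(** The binomial expansion of [((1 + X) + (1 - X)) ^ m]: the constant
    polynomial is a combination of eigenvectors. *)
Lemma kravchuk_sum m p :
  \sum_(i < m.+1) ('C(m, i))%:R * (kravchuk m i)`_p = (2 ^ m * (p == 0))%:R.
Proof.
have : \sum_(i < m.+1) kravchuk m i *+ 'C(m, i) = (2 ^ m)%:R.
  transitivity (((1 + 'X) + (1 - 'X)) ^+ m : {poly R}).
    rewrite exprDn; apply: eq_bigr => i _; rewrite mulrC //.
  by rewrite addrACA subrr addr0 natrX.
move/(congr1 (fun q : {poly R} => q`_p)); rewrite coef_sum.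
under eq_bigr => i _ do rewrite coefMn -mulr_natl.
by move=> ->; rewrite -polyC_natr coefC natrM; case: eqP; rewrite ?mulr1 ?mulr0.
Qed.

Lemma size_kravchuk m i : (i <= m)%N -> (size (kravchuk m i) <= m.+1)%N.
Proof.
move=> im; apply: leq_trans (size_polyMleq _ _) _.
have sP (e : R) k : (size ((1 + e *: 'X)%R ^+ k : {poly R})%R <= k.+1)%N.
  apply: leq_trans (size_poly_exp_leq _ _) _; rewrite ltnS.
  have : (size (1 + e *: 'X : {poly R})%R <= 2)%N.
    by rewrite (leq_trans (size_polyD _ _)) // geq_max size_poly1 (leq_trans (size_scale_leq _ _)) ?size_polyX.
  by move=> sz; rewrite -[X in (_ <= X)%N]mul1n leq_mul2r -subn1 leq_subLR sz orbT.
have s1 := sP 1 (m - i)%N; have s2 := sP (-1) i; rewrite scaleN1r in s2; rewrite scale1r in s1.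
rewrite -subn1 leq_subLR; apply: leq_trans (leq_add s2 s1) _; lia.
Qed.

Lemma kravchuk_out m i : (i <= m)%N -> (kravchuk m i)`_m.+1 = 0.
Proof. by move=> im; apply/nth_default/size_kravchuk. Qed.

End Kravchuk.

(** * The algebra generated by the adjacency matrix and the marking *)

Section PathAlgebra.
Variables (R : realType) (N d : nat) (B F : 'M[R]_N) (w : nat -> nat -> nat -> 'M[R]_N).
Hypothesis d_gt0 : (0 < d)%N.
Hypothesis HW : path_units d B F w.
Local Notation h := (d %/ 2)%N.
Local Notation n := (path_size d).
Local Notation b := (path_weight R d).
Local Notation W := (units_span (fun j : 'I_h.+1 => n j) (fun j : 'I_h.+1 => w j)).
Local Notation S := (gen_alg [set B; F]%classic).

Let U : matrix_units (fun j : 'I_h.+1 => n j) (fun j : 'I_h.+1 => w j) := path_matrix_units HW.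
Let WW : is_subalgebra W := units_span_subalgebra U.
Let SS : is_subalgebra S := gen_alg_subalgebra _.

Lemma path_size_gt0 j : (j <= h)%N -> (0 < n j)%N.
Proof. by rewrite /path_size /path_start; lia. Qed.

Lemma path_mul j k p q r s : (j <= h)%N -> (k <= h)%N ->
    (p < n j)%N -> (q < n j)%N -> (r < n k)%N -> (s < n k)%N ->
  w j p q *m w k r s = if (j == k) && (q == r) then w j p s else 0.
Proof.
move=> jh kh pj qj rk sk; case: U => wM _ _.
by have := @wM (inord j) p q (inord k) r s; rewrite -val_eqE /= !inordK //; apply.
Qed.

Lemma path_unit_neq0 j p q : (j <= h)%N -> (p < n j)%N -> (q < n j)%N -> w j p q != 0.
Proof.
move=> jh pj qj; have := @units_neq0 _ _ _ _ _ U (inord j) p q.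
by rewrite !inordK //; apply.
Qed.

Lemma path_unit_mem j p q : (j <= h)%N -> (q < n j)%N -> W (w j p q).
Proof.
move=> jh qj; case: (ltnP p (n j)) => pj; last first.
  by rewrite (path_out HW) //; exact: subalg0.
have := @units_span_unit _ _ _ _ _ U (inord j) p q.
by rewrite !inordK //; apply.
Qed.

Lemma path_weight_neq0 j p : (j <= h)%N -> (0 < p < n j)%N -> b j p != 0.
Proof.
by rewrite /path_size /path_start => jh pj; apply: casimir_value_neq; rewrite /path_start; lia.
Qed.

Lemma adj_mem : W B.
Proof.
apply: (units_span_left U) => j p pj; have jh : (j <= h)%N by rewrite -ltnS.
case: p pj => [|p] pj; first by rewrite (path_adj0 HW) //; exact: path_unit_mem.
rewrite (path_adjS HW) //; apply: (subalgD WW); first exact: path_unit_mem.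
by apply: (subalgZ WW); apply: path_unit_mem.
Qed.

Lemma mark_mem : W F.
Proof.
apply: (units_span_left U) => j p pj; have jh : (j <= h)%N by rewrite -ltnS.
by rewrite (path_mark HW) //; case: ifP => _; [exact: path_unit_mem|exact: subalg0].
Qed.

Lemma path_algebra_sub : (S `<=` W)%classic.
Proof. by apply: gen_alg_min => // M [->|->]; [exact: adj_mem|exact: mark_mem]. Qed.

Lemma adj_gen : S B. Proof. by apply: gen_alg_incl; left. Qed.
Lemma mark_gen : S F. Proof. by apply: gen_alg_incl; right. Qed.

Lemma mark_sum : F = \sum_(j < h.+1 | (j <= 1)%N) w j 0 0.
Proof.
case: U => _ w1 _; rewrite -[LHS]mulmx1 -w1 mulmx_sumr [RHS]big_mkcond.
apply: eq_bigr => j _; have jh : (j <= h)%N by rewrite -ltnS.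
rewrite mulmx_sumr (bigD1 (Ordinal (path_size_gt0 jh))) //= [X in _ + X]big1 ?addr0 => [|p p0].
  by rewrite (path_mark HW) // eqxx andbT.
rewrite (path_mark HW) //; case: ifP => // /andP[_ /eqP p0'].
by case/eqP: p0; apply: val_inj.
Qed.

(** A walk of two steps from the first vertex of a block returns to it with
    the weight [b j 1]. This weight differs between the blocks 0 and 1,
    which is what separates them. *)
Lemma mark_return j : (j <= h)%N -> (j <= 1)%N ->
  F *m (B *m (B *m w j 0 0)) = b j 1 *: w j 0 0.
Proof.
move=> jh j1; rewrite (path_adj0 HW) // (path_adjS HW) // mulmxDr -scalemxAr.
by rewrite !(path_mark HW) // j1 /= add0r.
Qed.

(** [F] is the sum of the two corner units, and [F B^2 F] is their
    combination with the coefficients [b 0 1] and [b 1 1]. As [b 0 1 - b 1 1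
    = d], the linear system can be solved. *)
Lemma corner_unit_mem j : (j <= h)%N -> (j <= 1)%N -> S (w j 0 0).
Proof.
case: (posnP h) => [h0|h0] jh j1.
  have -> : w j 0 0 = F.
    have j0 : j = 0%N by lia.
    by rewrite mark_sum h0 big_mkcond big_ord1 j0.
  exact: mark_gen.
have F2 : F = w 0 0 0 + w 1 0 0.
  rewrite mark_sum; have -> : h = h.-1.+1 by lia.
  by rewrite big_mkcond !big_ord_recl /= big1 ?addr0.
have FBBF : F *m (B *m (B *m F)) = b 0 1 *: w 0 0 0 + b 1 1 *: w 1 0 0.
  by rewrite {2}F2 !mulmxDr !mark_return.
have b01 : b 0 1 - b 1 1 = d%:R.
  by rewrite /path_weight /path_start /casimir_value /= !natrD; ring.
have d0 : d%:R != 0 :> R by rewrite pnatr_eq0 -lt0n.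
have SF := mark_gen; have SB := adj_gen.
have SFBBF : S (F *m (B *m (B *m F))) by do 3![apply: (subalgM SS) => //].
have w0 : w 0 0 0 = d%:R^-1 *: (F *m (B *m (B *m F)) - b 1 1 *: F).
  rewrite FBBF F2 [b 1 1 *: (_ + _)]scalerDr [b 1 1 *: w 0 0 0 + _]addrC addrKA -scalerBl b01 scalerA mulVf // scale1r //.
have w1 : w 1 0 0 = F - w 0 0 0 by rewrite F2 addrC addKr.
have S0 : S (w 0 0 0).
  rewrite w0; apply: (subalgZ SS); apply: (subalgB SS) => //; exact: (subalgZ SS).
by case: j j1 jh => [|[|]] // _ _; rewrite w1; apply: (subalgB SS).
Qed.

(** From a corner unit, [B] reaches the vertices of the path one after the
    other. *)
Lemma column_mem j p : (j <= h)%N -> (j <= 1)%N -> S (w j p 0).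
Proof.
move=> jh j1; suff /(_ p)[] : forall p, S (w j p 0) /\ S (w j p.+1 0) by [].
elim=> [|q [IH1 IH2]].
  split; first exact: corner_unit_mem.
  by rewrite -(path_adj0 HW) //; apply: (subalgM SS adj_gen); exact: corner_unit_mem.
split=> //; have -> : w j q.+2 0 = B *m w j q.+1 0 - b j q.+1 *: w j q 0 by rewrite (path_adjS HW) // addrK.
by apply: (subalgB SS); [apply: (subalgM SS adj_gen)|apply: (subalgZ SS)].
Qed.

Lemma row_mem j q : (j <= h)%N -> (j <= 1)%N -> (q < n j)%N -> S (w j 0 q).
Proof.
move=> jh j1; case: q => [|q]; first by move=> _; exact: corner_unit_mem.
move=> qn; suff [] : S (w j 0 q) /\ S (w j 0 q.+1) by [].
elim: q qn => [|q IH] qn.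
  have S0 : S (w j 0 0) by exact: corner_unit_mem.
  have b1 : b j 1 != 0 by apply: path_weight_neq0.
  split=> //; rewrite -[w j 0 1](scale1r) -(mulVf b1) -scalerA -(path_radj0 HW) //.
  by apply: (subalgZ SS); apply: (subalgM SS) => //; exact: adj_gen.
have [S0 S1] := IH (ltnW qn).
have b2 : b j q.+2 != 0 by apply: path_weight_neq0.
split=> //; rewrite -[w j 0 q.+2](scale1r) -(mulVf b2) -scalerA.
have -> : b j q.+2 *: w j 0 q.+2 = w j 0 q.+1 *m B - w j 0 q.
  by rewrite (path_radjS HW) ?addrK // ltnW.
by apply: (subalgZ SS); apply: (subalgB SS) => //; apply: (subalgM SS) => //; exact: adj_gen.
Qed.

Lemma block_mem j p q : (j <= h)%N -> (j <= 1)%N -> (p < n j)%N -> (q < n j)%N -> S (w j p q).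
Proof.
move=> jh j1 pj qj; have -> : w j p q = w j p 0 *m w j 0 q.
  by rewrite path_mul ?eqxx ?path_size_gt0.
by apply: (subalgM SS); [exact: column_mem|exact: row_mem].
Qed.

(** The projection onto the blocks without a marked vertex. *)
Definition hidden : 'M[R]_N := \sum_(j < h.+1 | (1 < j)%N) \sum_(p < n j) w j p p.
Local Notation f := hidden.

Lemma hidden_split : 1%:M = \sum_(j < h.+1 | (j <= 1)%N) \sum_(p < n j) w j p p + f.
Proof.
case: U => _ <- _; rewrite (bigID (fun j : 'I_h.+1 => (j <= 1)%N)) /=; congr (_ + _).
by apply: eq_bigl => j; rewrite ltnNge.
Qed.

Lemma hidden_mem : S f.
Proof.
have -> : f = 1%:M - \sum_(j < h.+1 | (j <= 1)%N) \sum_(p < n j) w j p p.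
  by rewrite hidden_split addrC addKr.
apply: (subalgB SS); first exact: subalg1.
apply: (subalg_sum SS) => j j1; apply: (subalg_sum SS) => p _.
by apply: block_mem; rewrite // -ltnS.
Qed.

Lemma hidden_unit j p q : (j <= h)%N -> (p < n j)%N -> (q < n j)%N ->
  f *m w j p q = if (1 < j)%N then w j p q else 0.
Proof.
move=> jh pj qj; rewrite /f mulmx_suml big_mkcond.
have jh' : (j < h.+1)%N by [].
rewrite (bigD1 (Ordinal jh')) //= [X in _ + X]big1 ?addr0 => [|k kj].
  case: ifP => // j1; rewrite mulmx_suml (bigD1 (Ordinal pj)) //= [X in _ + X]big1 ?addr0 => [|r rp].
    by rewrite path_mul // !eqxx.
  rewrite path_mul // eqxx /=; case: eqP => // rp'.
  by case/eqP: rp; apply: val_inj.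
case: ifP => // _; rewrite mulmx_suml big1 // => r _.
have kh : (k <= h)%N by rewrite -ltnS.
rewrite path_mul //; case: eqP => // kj'.
by case/eqP: kj; apply: val_inj.
Qed.

Lemma unit_hidden j p q : (j <= h)%N -> (p < n j)%N -> (q < n j)%N ->
  w j p q *m f = if (1 < j)%N then w j p q else 0.
Proof.
move=> jh pj qj; rewrite /f mulmx_sumr big_mkcond.
have jh' : (j < h.+1)%N by [].
rewrite (bigD1 (Ordinal jh')) //= [X in _ + X]big1 ?addr0 => [|k kj].
  case: ifP => // j1; rewrite mulmx_sumr (bigD1 (Ordinal qj)) //= [X in _ + X]big1 ?addr0 => [|r rp].
    by rewrite path_mul // !eqxx.
  rewrite path_mul // eqxx /=; case: eqP => // rp'.
  by case/eqP: rp; apply: val_inj.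
case: ifP => // _; rewrite mulmx_sumr big1 // => r _.
have kh : (k <= h)%N by rewrite -ltnS.
rewrite path_mul //; case: eqP => // kj'.
by case/eqP: kj; apply: val_inj; rewrite /= kj'.
Qed.

Lemma hidden_central M : W M -> M *m f = f *m M.
Proof.
apply: (units_span_min (centralizer_subalgebra f)) => j p q pj qj /=.
have jh : (j <= h)%N by rewrite -ltnS.
by rewrite unit_hidden // hidden_unit.
Qed.

Lemma hidden_idem : f *m f = f.
Proof.
rewrite {2}/f mulmx_sumr; apply: eq_bigr => j j1; rewrite mulmx_sumr; apply: eq_bigr => p _.
have jh : (j <= h)%N by rewrite -ltnS.
by rewrite hidden_unit // j1.
Qed.

Lemma mark_hidden : F *m f = 0.
Proof.
rewrite /f mulmx_sumr big1 // => j j1; rewrite mulmx_sumr big1 // => p _.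
by rewrite (path_mark HW) -1?ltnS // [(j < 2)%N]ltnNge j1.
Qed.

(** The scaling by falling factorials makes the weighted path of a hidden
    block act on the coefficients of a polynomial as [q |-> m X q + (1 -
    X^2) q']. *)
Definition column j p : 'M[R]_N := ((n j).-1 ^_ p)%:R^-1 *: w j p 0.

Lemma adj_column j p : (1 < j <= h)%N -> (p < n j)%N ->
  B *m column j p = ((n j).-1%:R - p%:R) *: column j p.+1
    + (if p is p'.+1 then p%:R *: column j p' else 0).
Proof.
move=> /andP[j1 jh] pj; rewrite /column -scalemxAr.
have [m dE] : exists m, d = (m + j.*2)%N by exists (d - j.*2)%N; lia.
have nj : n j = m.+1 by rewrite /path_size /path_start; lia.
rewrite nj /= in pj *.
have fa k : (k <= m)%N -> (m ^_ k)%:R != 0 :> R by move=> km; rewrite pnatr_eq0 -lt0n ffact_gt0.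
have up : (m ^_ p)%:R^-1 *: w j p.+1 0 = ((m%:R - p%:R) * (m ^_ p.+1)%:R^-1) *: w j p.+1 0.
  case: (ltnP p m) => pm; last by rewrite (path_out HW) ?scaler0 // nj.
  rewrite ffactnSr natrM natrB 1?ltnW // invfM mulrCA mulfV ?mulr1 //.
  by rewrite subr_eq0 eqr_nat neq_ltn pm orbT.
case: p pj up => [|p] pj up; first by rewrite (path_adj0 HW) // addr0 up scalerA.
rewrite (path_adjS HW) // scalerDr up !scalerA; congr (_ + _ *: _).
have -> : b j p.+1 = p.+1%:R * (m - p)%:R.
  rewrite /path_weight casimir_valueB /path_start (maxn_idPr (ltnW j1)).
  have dR : d%:R = m%:R + j%:R *+ 2 :> R by rewrite [in LHS]dE natrD -muln2 natrM mulr_natr.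
  rewrite (natrB _ (ltnW (pj : (p < m)%N))) (natrD _ j p.+1) (natrD _ j (j + p.+1)) (natrD _ j p.+1) dR.
  by rewrite -[p.+1%:R]natr1; ring.
rewrite ffactnSr natrM invfM mulrCA -mulrA mulVf ?mulr1 //.
by rewrite pnatr_eq0 subn_eq0 -ltnNge.
Qed.

Definition eigencolumn j i : 'M[R]_N :=
  \sum_(p < n j) (kravchuk R (n j).-1 i)`_p *: column j p.

Lemma adj_eigencolumn j i : (1 < j <= h)%N -> (i < n j)%N ->
  B *m eigencolumn j i = ((n j).-1%:R - i%:R *+ 2) *: eigencolumn j i.
Proof.
move=> jh ij; have /andP[j1 jh'] := jh.
have im : (i <= (n j).-1)%N by lia.
have nj : n j = (n j).-1.+1 by lia.
rewrite /eigencolumn; set k := fun p => (kravchuk R (n j).-1 i)`_p.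
set m := (n j).-1 in im nj *.
rewrite mulmx_sumr scaler_sumr.
under eq_bigr => p _ do rewrite -scalemxAr (adj_column jh (ltn_ord p)) scalerDr scalerA.
rewrite big_split /= nj.
have -> : \sum_(p < m.+1) (k p * (m%:R - p%:R)) *: column j p.+1
    = \sum_(p < m) (k p * (m%:R - p%:R)) *: column j p.+1.
  by rewrite big_ord_recr /= subrr mulr0 scale0r addr0.
have -> : \sum_(p < m.+1) k p *: (if p : nat is p'.+1 then p%:R *: column j p' else 0)
    = k 1%N *: column j 0 + \sum_(p < m) (p.+2%:R * k p.+2) *: column j p.+1.
  rewrite big_ord_recl /= scaler0 add0r.
  transitivity (\sum_(p < m.+1) (p.+1%:R * k p.+1) *: column j p).
    rewrite big_ord_recr /= /k kravchuk_out // mulr0 scale0r addr0.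
    by apply: eq_bigr => p _; rewrite scalerA mulrC.
  by rewrite big_ord_recl /= mul1r.
rewrite [RHS]big_ord_recl /= addrCA; congr (_ + _).
  by rewrite [RHS]scalerA /k kravchuk_rec0.
rewrite -big_split; apply: eq_bigr => p _ /=.
by rewrite -scalerDl [RHS]scalerA /k -kravchuk_rec // [in LHS](mulrC (kravchuk _ _ _)`_p).
Qed.

(** The first basis vector corresponds to the constant polynomial. *)
Lemma column_eigencolumns j : (1 < j <= h)%N ->
  w j 0 0 = \sum_(i < n j) ((2 ^ (n j).-1)%:R^-1 * 'C((n j).-1, i)%:R) *: eigencolumn j i.
Proof.
move=> /andP[j1 jh].
have ks m p : (0 < m)%N -> \sum_(i < m) ('C(m.-1, i))%:R * (kravchuk R m.-1 i)`_p
    = (2 ^ m.-1 * (p == 0%N))%:R by case: m => // m _; exact: kravchuk_sum.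
under eq_bigr => i _ do rewrite -scalerA scaler_sumr.
rewrite -scaler_sumr exchange_big /=.
under eq_bigr => p _ do under eq_bigr => i _ do rewrite scalerA.
under eq_bigr => p _ do rewrite -scaler_suml ks ?path_size_gt0 //.
rewrite (bigD1 (Ordinal (path_size_gt0 jh))) //= [X in _ + X]big1 ?addr0 => [|p p0].
  by rewrite muln1 scalerA mulVf ?scale1r ?pnatr_eq0 ?expn_eq0 // /column ffactn0 invr1 scale1r.
by rewrite (_ : (p == 0%N :> nat) = false) ?muln0 ?scale0r //; apply/negbTE.
Qed.

Lemma corner_eigencolumn j i : (1 < j <= h)%N -> w j 0 0 *m eigencolumn j i = w j 0 0.
Proof.
move=> /andP[j1 jh]; have n0 := path_size_gt0 jh.
rewrite /eigencolumn mulmx_sumr (bigD1 (Ordinal n0)) //= [X in _ + X]big1 ?addr0 => [|p p0].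
  by rewrite kravchuk_coef0 scale1r /column ffactn0 invr1 scale1r path_mul ?eqxx.
rewrite -!scalemxAr path_mul // eqxx /= eq_sym.
by rewrite (_ : (p == 0%N :> nat) = false) ?scaler0 //; apply/negbTE.
Qed.

Definition hidden_eigenvalue (i : nat) : R := d%:R - 4 - i%:R *+ 2.

Lemma hidden_eigenvalue_inj : injective (fun i : 'I_(d - 3) => hidden_eigenvalue i).
Proof.
move=> i k /addrI/oppr_inj; rewrite -2!mulrnA => /eqP; rewrite eqr_nat => /eqP ik.
by apply: val_inj => /=; lia.
Qed.

(** The spectrum of the hidden block [j] is contained in that of the block
    2, which is the largest one. This is why the number of one-dimensional
    summands depends on the block 2 alone. *)
Lemma block_eigenvalue j i : (1 < j <= h)%N -> (i < n j)%N ->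
  (n j).-1%:R - i%:R *+ 2 = hidden_eigenvalue (j - 2 + i) :> R.
Proof.
move=> /andP[j1 jh]; rewrite /path_size /path_start (maxn_idPr (ltnW j1)) => _.
have [m dE] : exists m, d = (m + j.*2)%N by exists (d - j.*2)%N; lia.
have -> : ((d - j).+1 - j).-1 = m by lia.
have dR : d%:R = m%:R + j%:R *+ 2 :> R by rewrite [in LHS]dE natrD -muln2 natrM mulr_natr.
by rewrite /hidden_eigenvalue dR (natrD _ (j - 2) i) (natrB _ j1); ring.
Qed.

Local Notation q := (\prod_(k < d - 3) (B - (hidden_eigenvalue k)%:M)).

(** The first column of each hidden block is a sum of eigenvectors for the
    listed eigenvalues; the other columns follow by applying [B], with which
    the product commutes. *)
Lemma hidden_annihilated : q *m f = 0.
Proof.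
have qB : q *m B = B *m q.
  apply: esym; apply: commr_prod => k _.
  by rewrite /GRing.comm -[LHS]/(B *m _) -[RHS]/(_ *m B) mulmxBl mulmxBr scalar_mxC.
rewrite /f mulmx_sumr big1 // => j j1; rewrite mulmx_sumr big1 // => p _.
have jh : (j <= h)%N by rewrite -ltnS.
have jj : (1 < j <= h)%N by rewrite j1.
have q0 : q *m w j 0 0 = 0.
  rewrite column_eigencolumns // mulmx_sumr big1 // => i _; rewrite -scalemxAr.
  rewrite (prod_eigen _ _ (adj_eigencolumn jj (ltn_ord i))) block_eigenvalue //.
  have ik : (j - 2 + i < d - 3)%N.
    by move: (nat_of_ord i) (ltn_ord i) => l; rewrite /path_size /path_start; lia.
  by rewrite (bigD1 (Ordinal ik)) //= subrr mul0r scale0r scaler0.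
have qp r : q *m w j r 0 = 0 /\ q *m w j r.+1 0 = 0.
  elim: r => [|r [IH1 IH2]]; first by rewrite -(path_adj0 HW) // mulmxA qB -mulmxA q0 mulmx0.
  split=> //; have -> : w j r.+2 0 = B *m w j r.+1 0 - b j r.+1 *: w j r 0 by rewrite (path_adjS HW) // addrK.
  by rewrite mulmxBr mulmxA qB -mulmxA IH2 mulmx0 -scalemxAr IH1 scaler0 subr0.
have -> : w j p p = w j p 0 *m w j 0 p by rewrite path_mul ?eqxx ?path_size_gt0.
by rewrite mulmxA (qp p).1 mul0mx.
Qed.

Lemma eigencolumn_neq0 j i : (1 < j <= h)%N -> eigencolumn j i != 0.
Proof.
move=> jj; have /andP[_ jh] := jj; apply: contraNneq (path_unit_neq0 jh (path_size_gt0 jh) (path_size_gt0 jh)).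
by move=> e0; rewrite -(corner_eigencolumn i jj) e0 mulmx0.
Qed.

Lemma hidden_eigencolumn j i : (1 < j <= h)%N -> f *m eigencolumn j i = eigencolumn j i.
Proof.
move=> /andP[j1 jh]; rewrite mulmx_sumr; apply: eq_bigr => p _.
by rewrite /column -!scalemxAr hidden_unit ?path_size_gt0 // j1.
Qed.

(** On the hidden blocks [F] vanishes, so that only polynomials in [B]
    remain. *)
Lemma path_algebra_hidden M : S M -> M *m f *m B = B *m (M *m f).
Proof.
have Bf := hidden_central adj_mem.
pose C : set 'M[R]_N := [set M | W M /\ M *m f *m B = B *m (M *m f)]%classic.
suff CS : (S `<=` C)%classic by move=> /CS [].
apply: gen_alg_min => [|_ [->|->]]; last 2 first.
- by split; [exact: adj_mem|rewrite -mulmxA -Bf].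
- by split; [exact: mark_mem|rewrite mark_hidden mul0mx mulmx0].
split=> [|k x y [Wx xC] [Wy yC]|x y [Wx xC] [Wy yC]].
- by split; [exact: subalg1|rewrite mul1mx Bf].
- split; first by apply: (subalgD WW) => //; exact: subalgZ.
  by rewrite !(mulmxDl, mulmxDr) -!scalemxAl -scalemxAr xC yC.
- split; first exact: subalgM.
  rewrite -2!mulmxA (mulmxA y) yC (hidden_central Wy) !mulmxA -(mulmxA x) Bf mulmxA xC.
  by rewrite -!mulmxA (hidden_central Wy).
Qed.

(** For [d >= 5] the block 2 has size at least 2 and its unit [w 2 0 0] does
    not commute with [B], so the smaller algebra misses it. For [d <= 4] a
    hidden block exists only if [d = 4]; it is then the block 2, of size 1,
    and its unit is [hidden]. *)
Theorem path_algebra_full : S = W <-> (d <= 4)%N.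
Proof.
split=> [SW|d4].
  rewrite leqNgt; apply/negP => d5.
  have h2 : (2 <= h)%N by lia.
  have n2 : (1 < n 2)%N by rewrite /path_size /path_start; lia.
  have n0 : (0 < n 2)%N by lia.
  have : S (w 2 0 0) by rewrite SW; apply: path_unit_mem.
  move=> /path_algebra_hidden; rewrite unit_hidden //= (path_radj0 HW) // (path_adj0 HW) //.
  move=> /(congr1 (mulmx (w 2 0 0))); rewrite -scalemxAr !path_mul //= => /eqP.
  by rewrite scaler_eq0 (negPf (path_weight_neq0 h2 _)) //= (negPf (path_unit_neq0 h2 _ _)).
apply/seteqP; split; first exact: path_algebra_sub.
apply: (units_span_min SS) => j p q pj qj; have jh : (j <= h)%N by rewrite -ltnS.
case: (leqP j 1) => j1; first exact: block_mem.
have dE : d = 4 by lia.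
have j2 : j = 2 :> nat by lia.
have [p0 q0] : p = 0%N /\ q = 0%N.
  by move: pj qj; rewrite /path_size /path_start j2 dE; lia.
suff -> : w j p q = f by exact: hidden_mem.
rewrite p0 q0 /f (bigD1 j) //= [X in _ + X]big1 ?addr0 => [|k kj1]; last first.
  have [k1 kj] := andP kj1; have kh : (k <= h)%N by rewrite -ltnS.
  by case/eqP: kj; apply: val_inj => /=; lia.
have nj : n j = 1%N by rewrite /path_size /path_start; lia.
by rewrite nj big_ord1.
Qed.

Definition algebra_size (k : bool + 'I_(d - 3)) : nat :=
  match k with inl true => d | inl false => d - 1 | inr _ => 1 end.

Definition algebra_unit (pi : 'I_(d - 3) -> 'M[R]_N) (k : bool + 'I_(d - 3)) (p q : nat) :=
  match k with inl true => w 0 p q | inl false => w 1 p q | inr i => pi i end.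

Hypothesis d_gt1 : (1 < d)%N.

Lemma algebra_sizeE c : algebra_size (inl c) = n (~~ c).
Proof. by case: c; rewrite /= /path_size /path_start; lia. Qed.

Lemma algebra_unitE pi c : algebra_unit pi (inl c) = w (~~ c).
Proof. by case: c. Qed.

(** The blocks 0 and 1 are obtained in full. On the hidden part the algebra
    is spanned by the spectral projections of [B]; they do not vanish,
    because each eigenvalue has an eigenvector in the block 2. *)
Lemma algebra_units : exists pi : 'I_(d - 3) -> 'M[R]_N,
  matrix_units algebra_size (algebra_unit pi) /\ S = units_span algebra_size (algebra_unit pi).
Proof.
have Bf := esym (hidden_central adj_mem).
have [pi [pi1 piM Bpi piB piS]] :=
  spectral_idempotents hidden_eigenvalue_inj hidden_idem (esym Bf) hidden_annihilated.
have Spi k : S (pi k) by apply: piS; [exact: SS|exact: adj_gen|exact: hidden_mem].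
have pif k : pi k *m f = pi k.
  rewrite -pi1 mulmx_sumr (bigD1 k) //= piM eqxx big1 ?addr0 // => l lk.
  by rewrite piM eq_sym (negPf lk).
have fpi k : f *m pi k = pi k.
  rewrite -pi1 mulmx_suml (bigD1 k) //= piM eqxx big1 ?addr0 // => l lk.
  by rewrite piM (negPf lk).
have ch (c : bool) : (~~ c <= h)%N by case: c => //=; lia.
have c1 (c : bool) : (1 < ~~ c)%N = false by case: c.
have fw c p r : (p < n (~~ c))%N -> (r < n (~~ c))%N -> f *m w (~~ c) p r = 0.
  by move=> pc rc; rewrite hidden_unit ?ch // c1.
have wf c p r : (p < n (~~ c))%N -> (r < n (~~ c))%N -> w (~~ c) p r *m f = 0.
  by move=> pc rc; rewrite unit_hidden ?ch // c1.
have AU : matrix_units algebra_size (algebra_unit pi).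
  split.
  - move=> [c|i] p r [c'|i'] p' r'; rewrite ?algebra_sizeE ?algebra_unitE => pc rc pc' rc'.
    + rewrite path_mul ?ch //; congr (if _ && _ then _ else _).
      by case: c c' {pc rc pc' rc'} => [] [].
    + by rewrite /= -fpi mulmxA wf // mul0mx.
    + by rewrite /= -pif -mulmxA fw // mulmx0.
    + rewrite /= piM -[inr i == inr i']/(i == i'); case: eqP => //= _.
      by move: rc pc'; rewrite !ltnS !leqn0 => /eqP -> /eqP ->.
  - rewrite hidden_split big_sumType /=; congr (_ + _); last first.
      by rewrite -pi1; apply: eq_bigr => i _; rewrite big_ord1.
    transitivity (\sum_(p < n 0) w 0 p p + \sum_(p < n 1) w 1 p p).
      by rewrite big_bool /= -(algebra_sizeE true) -(algebra_sizeE false).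
    have -> : h = h.-1.+1 by lia.
    by rewrite [RHS]big_mkcond !big_ord_recl /= [X in _ = _ + (_ + X)]big1 ?addr0.
  - move=> [c|i] p; first by rewrite algebra_sizeE algebra_unitE => pc; apply: path_unit_neq0.
    move=> _ /=.
    have j2 : (1 < 2 <= h)%N by have := ltn_ord i; lia.
    have i2 : (i < n 2)%N by have := ltn_ord i; rewrite /path_size /path_start; lia.
    have Bi := adj_eigencolumn j2 i2; rewrite block_eigenvalue // add0n in Bi.
    apply: contraNneq (eigencolumn_neq0 i j2) => pi0.
    rewrite -(hidden_eigencolumn i j2) -pi1 mulmx_suml big1 // => k _.
    case: (eqVneq k i) => [->|ki]; first by rewrite pi0 mul0mx.
    have : pi k *m (B *m eigencolumn 2 i) = hidden_eigenvalue k *: (pi k *m eigencolumn 2 i).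
      by rewrite mulmxA piB scalemxAl.
    rewrite Bi -scalemxAr => /eqP; rewrite -subr_eq0 -scalerBl scaler_eq0 subr_eq0.
    by rewrite (inj_eq hidden_eigenvalue_inj) eq_sym (negPf ki) => /eqP.
exists pi; split=> //.
have ASS := units_span_subalgebra AU.
have Aw c p r : (r < n (~~ c))%N -> units_span algebra_size (algebra_unit pi) (w (~~ c) p r).
  move=> rc; case: (ltnP p (n (~~ c))) => pc; last first.
    by rewrite (path_out HW) ?ch //; exact: subalg0.
  by rewrite -(algebra_unitE pi); apply: (units_span_unit AU); rewrite algebra_sizeE.
have Api i : units_span algebra_size (algebra_unit pi) (pi i).
  exact: (@units_span_unit _ _ _ _ _ AU (inr i) 0 0).
apply/seteqP; split.
  apply: gen_alg_min => // M [->|->]; apply: (units_span_left AU) => -[c|i] p;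
    rewrite ?algebra_sizeE ?algebra_unitE => pc.
  - case: p pc => [|p] pc; first by rewrite (path_adj0 HW) ?ch //; apply: Aw.
    rewrite (path_adjS HW) ?ch //; apply: (subalgD ASS); first exact: Aw.
    by apply: (subalgZ ASS); apply: Aw.
  - by rewrite /= Bpi; apply: (subalgZ ASS).
  - by rewrite (path_mark HW) ?ch //; case: ifP => _; [exact: Aw|exact: subalg0].
  - by rewrite /= -fpi mulmxA mark_hidden mul0mx; exact: subalg0.
apply: units_span_min => // -[c|i] p r; last by move=> _ _; exact: Spi.
rewrite algebra_sizeE algebra_unitE => pc rc; apply: block_mem => //.
by case: c {pc rc}.
Qed.

Theorem path_algebra_iso : S ~=alg 'M[R]_d * 'M[R]_(d - 1) * {ffun 'I_(d - 3) -> R^o}.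
Proof.
have [pi [AU ->]] := algebra_units.
pose phi (x : 'M[R]_d * 'M[R]_(d - 1) * {ffun 'I_(d - 3) -> R^o}) : mxsum R algebra_size :=
  mxsum_map (fun k => match k return 'M[R]_(algebra_size k) with
    | inl true => x.1.1 | inl false => x.1.2 | inr i => (x.2 i)%:M end).
pose psi (y : mxsum R algebra_size) : 'M[R]_d * 'M[R]_(d - 1) * {ffun 'I_(d - 3) -> R^o} :=
  (y (inl true) : 'M[R]_d, y (inl false) : 'M[R]_(d - 1), [ffun i => (y (inr i) : 'M[R]_1) 0 0]).
apply: (alg_iso_trans (phi := phi) (psi := psi)) (units_span_iso AU).
- move=> x y; apply/mxsumP => -[[]|i]; rewrite !mxsumE //= !ffunE.
  by rewrite raddfB.
- split; first by apply/mxsumP => -[[]|i]; rewrite !mxsumE //= ffunE.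
  by move=> x y; apply/mxsumP => -[[]|i]; rewrite !mxsumE //= ffunE scalar_mxM.
- move=> k x; apply/mxsumP => -[[]|i]; rewrite !mxsumE //= ffunE.
  by rewrite -scale_scalar_mx.
- move=> [[x y] z]; rewrite /psi !mxsumE; congr (_, _, _); apply/ffunP => i.
  by rewrite ffunE mxsumE mxE eqxx.
- move=> y; apply/mxsumP => -[[]|i]; rewrite mxsumE //= ffunE.
  by rewrite -mx11_scalar.
Qed.

End PathAlgebra.

(** * The two algebras of the hypercube *)

Section Reindex.
Variables (R : realType) (N : nat) (K L : finType) (n : K -> nat) (m : L -> nat).
Variables (w : K -> nat -> nat -> 'M[R]_N) (s : L -> K).
Hypotheses (s_bij : bijective s) (ms : forall l, m l = n (s l)) (U : matrix_units n w).

Lemma matrix_units_reindex : matrix_units m (fun l => w (s l)).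
Proof.
case: U => wM w1 w0; split=> [k p q l r t||k p]; rewrite ?ms.
- by move=> pk qk rl tl; rewrite wM // (bij_eq s_bij).
- by rewrite -w1 (reindex s) /=; [apply: eq_bigr => l _; rewrite ms|exact: onW_bij].
- exact: w0.
Qed.

Lemma units_span_reindex : units_span m (fun l => w (s l)) = units_span n w.
Proof.
have V := matrix_units_reindex.
apply/seteqP; split; apply: units_span_min; try exact: units_span_subalgebra.
  by move=> l p q; rewrite !ms; exact: units_span_unit.
case: s_bij => t _ tK k p q pk qk; rewrite -(tK k).
by apply: (units_span_unit V); rewrite ms tK.
Qed.

End Reindex.

Section HypercubeAlgebras.
Variables (R : realType) (d : nat) (a : cube d).
Hypothesis d_gt0 : (0 < d)%N.
Local Notation h := (d %/ 2)%N.
Local Notation A := (algB R (@cube_adj d) a).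
Local Notation C := (corner R (@cube_adj d) a).

Lemma hypercube_path_units : exists B F w,
  [/\ path_units d B F w, A = gen_alg [set B; F]%classic &
      C = units_span (fun j : 'I_h.+1 => path_size d j) (fun j : 'I_h.+1 => w j)].
Proof.
have [P HP] := isotypic_exists (cube_graded_sl2 R a).
do 3!eexists; split; [exact: (residual_path_units d_gt0 HP)| |exact: corner_span].
by rewrite -residual_adj -residual_mark.
Qed.

Definition corner_size (k : unit + 'I_h) : nat :=
  match k with inl _ => d | inr j => d - 2 * j.+1 + 1 end.

Lemma corner_iso_mxsum : C ~=alg mxsum R corner_size.
Proof.
have [B [F [w [HW _ ->]]]] := hypercube_path_units.
pose s (k : unit + 'I_h) : 'I_h.+1 := if k is inr j then lift ord0 j else ord0.
have s_bij : bijective s.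
  exists (fun i => if unlift ord0 i is Some j then inr j else inl tt).
    by case=> [[]|j] /=; [rewrite unlift_none|rewrite liftK].
  by move=> i; case: unliftP => [j ->|->].
have ms k : corner_size k = path_size d (s k).
  case: k => [[]|j]; first by rewrite /= /path_size /path_start; lia.
  by have := ltn_ord j; rewrite /= /path_size /path_start /bump /=; lia.
rewrite -(units_span_reindex s_bij ms (path_matrix_units HW)).
by apply: units_span_iso; apply: matrix_units_reindex s_bij ms (path_matrix_units HW).
Qed.

Lemma corner_iso : C ~=alg 'M[R]_d * \oplus_(j < d %/ 2) 'M[R]_(d - 2 * j.+1 + 1).
Proof.
pose phi (x : 'M[R]_d * \oplus_(j < d %/ 2) 'M[R]_(d - 2 * j.+1 + 1)) : mxsum R corner_size :=
  mxsum_map (fun k => match k return 'M[R]_(corner_size k) with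
    | inl _ => x.1 | inr j => x.2 j end).
pose psi (y : mxsum R corner_size) : 'M[R]_d * \oplus_(j < d %/ 2) 'M[R]_(d - 2 * j.+1 + 1) :=
  (y (inl tt) : 'M[R]_d, mxsum_map (fun j : 'I_h => y (inr j) : 'M[R]_(d - 2 * j.+1 + 1))).
apply: (alg_iso_trans (phi := phi) (psi := psi)) corner_iso_mxsum.
- by move=> x y; apply/mxsumP => -[[]|j]; rewrite !mxsumE //= !mxsumE.
- by split=> [|x y]; apply/mxsumP => -[[]|j]; rewrite !mxsumE //= !mxsumE.
- by move=> k x; apply/mxsumP => -[[]|j]; rewrite !mxsumE //= !mxsumE.
- by move=> [x y]; rewrite /psi !mxsumE; congr (_, _); apply/mxsumP => j; rewrite !mxsumE.
- by move=> y; apply/mxsumP => -[[]|j]; rewrite !mxsumE //= !mxsumE.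
Qed.

Lemma algB_iso : (1 < d)%N -> A ~=alg 'M[R]_d * 'M[R]_(d - 1) * {ffun 'I_(d - 3) -> R^o}.
Proof.
by have [B [F [w [HW -> _]]]] := hypercube_path_units; exact: (path_algebra_iso d_gt0 HW).
Qed.

Lemma algB_eq_corner : A = C <-> (d <= 4)%N.
Proof.
by have [B [F [w [HW -> ->]]]] := hypercube_path_units; exact: (path_algebra_full d_gt0 HW).
Qed.

End HypercubeAlgebras.

Lemma corner_iso1 (R : realType) (a : cube 1) : corner R (@cube_adj 1) a ~=alg R^o.
Proof.
(* For d = 1 the second direct sum is empty. *)
have no_index (j : 'I_(1 %/ 2)) : False by case: j.
pose phi (x : R^o) : mxsum R (corner_size (d := 1)) :=
  mxsum_map (fun k => match k return 'M[R]_(corner_size k) with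
    | inl _ => x%:M | inr _ => 0 end).
pose psi (y : mxsum R (corner_size (d := 1))) : R^o := (y (inl tt) : 'M[R]_1) 0 0.
apply: (alg_iso_trans (phi := phi) (psi := psi)) (corner_iso_mxsum R a isT).
- by move=> x y; apply/mxsumP => -[[]|/no_index//]; rewrite !mxsumE //= raddfB.
- split=> [|x y]; apply/mxsumP => -[[]|/no_index//]; rewrite !mxsumE //=.
  by rewrite scalar_mxM.
- by move=> k x; apply/mxsumP => -[[]|/no_index//]; rewrite !mxsumE /= -scale_scalar_mx.
- by move=> x; rewrite /psi mxsumE mxE eqxx.
- by move=> y; apply/mxsumP => -[[]|/no_index//]; rewrite mxsumE /= -mx11_scalar.
Qed.

(* d - 3 is truncated subtraction, i.e. max(d - 3, 0); the summand of index
   j in the second line is the one of index j + 1 on paper. *)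
Theorem theorem6p4 (R : realType) :
  [/\ forall (d : nat) (a : cube d), (2 <= d)%N ->
        (algB R (@cube_adj d) a
           ~=alg 'M[R]_d * 'M[R]_(d - 1) * {ffun 'I_(d - 3) -> R^o})
        /\ (corner R (@cube_adj d) a
           ~=alg 'M[R]_d * \oplus_(j < d %/ 2) 'M[R]_(d - 2 * j.+1 + 1)),
      forall a : cube 1,
        (algB R (@cube_adj 1) a ~=alg R^o)
        /\ (corner R (@cube_adj 1) a ~=alg R^o),
      forall (d : nat) (a : cube d), (1 <= d)%N ->
        (algB R (@cube_adj d) a = corner R (@cube_adj d) a <-> (d <= 4)%N)
    & forall (d : nat) (a : cube d), (2 <= d)%N ->
        has_dim (algB R (@cube_adj d) a) (d ^ 2 + (d - 1) ^ 2 + (d - 3))].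
Proof.
split=> [d a d2|a|d a d1|d a d2].
- by split; [apply: algB_iso|apply: corner_iso]; rewrite // ltnW.
- have -> : algB R (@cube_adj 1) a = corner R (@cube_adj 1) a by apply/algB_eq_corner.
  by split; exact: corner_iso1.
- exact: algB_eq_corner.
- by apply: alg_iso_dim; apply: algB_iso; rewrite // ltnW.
Qed.
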